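(* Let $a,b$ be positive integers with $b$ squarefree. Then there are an integer $k\ge 1$ and integers $1<n_1<n_2<\dots<n_k$, each of which is a product of two distinct primes, such that $$\frac ab=\sum_{i=1}^k\frac1{n_i}.$$ *)

(* Defs.v *)
From mathcomp Require Import all_boot all_order all_algebra.

Set Implicit Arguments.
Unset Strict Implicit.
Unset Printing Implicit Defensive.

Definition squarefree (n : nat) : Prop :=
  forall d : nat, d ^ 2 %| n -> d = 1.

Definition product_of_two_distinct_primes (n : nat) : Prop :=
  exists p q : nat, [/\ prime p, prime q, p != q & n = p * q].

(* Main.v *)
Require Import Defs.
From mathcomp Require Import all_boot all_order all_algebra.
From mathcomp Require Import zify ring lra.
From Stdlib Require Import Classical.

(** Call a product [p q] of two distinct primes an edge between [p] and [q]; the task is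
    to write [a / b] as the sum of the reciprocals of finitely many edges.

    Intervals grow. Suppose that the sums of certain edges contain every number of an
    interval [[lo, hi]] that lies in [s0 + Z / m], for a product [m] of primes ([covers]).
    If [P] is a new prime and [C] is a list of primes dividing [m] such that every residue
    modulo [P] is a sum of reciprocals of distinct members of [C] ([complete P C]), then
    the edges [r P], [r] in [C], extend this to [s0 + Z / (m P)]: the residue of the target
    modulo [P] tells which of them to use. The price is to raise [lo] by the sum of all
    these edges ([covers_add_prime]). An unused edge between primes dividing [m], of
    reciprocal at most [hi - lo], raises [hi] ([covers_add_edge]). So once a first interval
    is found with [lo] below [1 / b] and with [hi - lo] larger than the price of adding all
    other primes, every prime up to a large bound can be put into [m]; then [s0] and [a / b]
    both belong to [Z / m], and the edges [2 P] with [P] large carry [hi] beyond [a / b],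
    because the sum of the inverses of the primes diverges.

    Complete lists. A list whose sub-sums modulo [q] have few coincidences has many
    sub-sums, and by averaging a prime can be chosen that creates few coincidences for many
    moduli [q] at once. Cauchy-Davenport adds up several such lists. This gives lists of
    primes below the moduli, much shorter than their size, that are complete for half of the
    moduli of any given set ([exists_complete]).

    The first interval. Let [L], [P2], [P3] be lists of primes with [P2] and [P3] complete
    modulo every prime [q] of a large set of slots. A gadget for [q] is a set of edges [r q]
    whose sum has no [q] in the denominator, so that it is a multiple of [1 / M], where [M]
    is the product of [L], [P2] and [P3]. Build a set [S] of sums of gadgets, one slot after
    the other. Either some gadget [g] of the current slot makes [S] grow by a factor
    [1 + 1 / N], or every gadget of the slot moves only a small part of [S] out of [S]. As
    [S] consists of multiples of [1 / M] in [[0, 1]], it has at most [M + 1] elements, so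
    growth stops ([stalled_slot]). For the slot [q] where it stops, differences of gadgets
    telescope to any small multiple of [1 / prodl L] ([stalled_translates]); hence [S] is
    almost invariant under these translations and contains most of a window of
    [s + Z / prodl L]. Two such sets, built on disjoint slots, add up to a full interval
    ([core_interval]). The logarithm of [M] is small because complete lists are short, and
    this keeps the interval longer than the price of all later steps. *)

Set Implicit Arguments.
Unset Strict Implicit.
Unset Printing Implicit Defensive.
Import Order.TTheory GRing.Theory Num.Theory.

Lemma expn2_dominates (c d : nat) :
  exists n0, forall n, n0 <= n -> c * n ^ d <= 2 ^ n.
Proof.
elim: d c => [|d IH] c.
  exists c => n cn; rewrite expn0 muln1.
  by apply: leq_trans cn _; apply: ltnW; apply: ltn_expl.
have [m0 Hm] := IH (c * 3 ^ d.+1).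
exists (2 * m0 + 2) => n hn.
have hm : m0 <= n./2 by lia.
have h3 : n <= 3 * n./2 by lia.
have h2 : n./2 + n./2 <= n by lia.
apply: (@leq_trans (2 ^ (n./2 + n./2))); last by rewrite leq_exp2l.
apply: (@leq_trans (c * (3 * n./2) ^ d.+1)).
  by rewrite leq_mul2l leq_exp2r ?h3 ?orbT.
rewrite expnMn mulnA [(n./2) ^ _]expnS [n./2 * _]mulnC mulnA expnD.
apply: leq_mul; first exact: Hm.
by apply: ltnW; apply: ltn_expl.
Qed.

(** * Counting primes *)

Definition primes_in (a b : nat) := [seq p <- iota a.+1 (b - a) | prime p].

Lemma mem_primes_in a b p : (p \in primes_in a b) = [&& prime p, a < p & p <= b].
Proof.
rewrite mem_filter mem_iota; case: (prime p) => //=.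
by apply/idP/idP => /andP[h1 h2]; apply/andP; split; lia.
Qed.

Lemma uniq_primes_in a b : uniq (primes_in a b).
Proof. by rewrite filter_uniq ?iota_uniq. Qed.

Lemma size_primes_in0 a b : size (primes_in 0 b) <= a + size (primes_in a b).
Proof.
rewrite !size_filter.
have [ab|ba] := leqP a b; last first.
  apply: leq_trans (count_size _ _) _; rewrite size_iota; lia.
have -> : b - 0 = a + (b - a) by lia.
rewrite iotaD count_cat add1n leq_add2r.
by apply: leq_trans (count_size _ _) _; rewrite size_iota.
Qed.

Lemma expn2_le_bin n : 2 ^ n <= 'C(n.*2, n).
Proof.
elim: n => // n IH; rewrite doubleS binS expnS mul2n -addnn.
apply: leq_add; first by rewrite binS; apply: leq_trans IH (leq_addl _ _).
case: n IH => [|n] IH; first by [].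
by rewrite [X in _ <= X]binS; apply: leq_trans IH (leq_addr _ _).
Qed.

(** By Legendre's formula the exponent of [p] counts the [k] such that the fractional part
    of [n / p^k] is at least [1/2]; only those with [p^k <= 2n] contribute. *)
Lemma expn_logn_bin p n : prime p -> 0 < n -> p ^ logn p 'C(n.*2, n) <= n.*2.
Proof.
move=> pp n0.
have p1 := prime_gt1 pp.
have hn2 : n <= n.*2 by lia.
suff h : logn p 'C(n.*2, n) <= trunc_log p n.*2.
  apply: (@leq_trans (p ^ trunc_log p n.*2)); first by rewrite leq_exp2l.
  by rewrite trunc_logP // double_gt0.
set l := trunc_log p n.*2.
have hb : 'C(n.*2, n) * (n`! * n`!) = n.*2`!.
  by rewrite -[in RHS](bin_fact hn2) -addnn addnK.
have hf : logn p n.*2`! = logn p 'C(n.*2, n) + (logn p n`! + logn p n`!).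
  by rewrite -hb !lognM ?muln_gt0 ?fact_gt0 ?bin_gt0.
have e1 : logn p n`! = \sum_(1 <= k < n.*2.+1) n %/ p ^ k.
  rewrite logn_fact // [RHS](@big_cat_nat _ _ _ n.+1) //=.
  rewrite [X in _ = _ + X]big1_seq ?addn0 // => i /=; rewrite mem_index_iota.
  by case/andP=> h _; apply: divn_small; apply: leq_trans h _; apply/ltnW/ltn_expl.
have hl : \sum_(1 <= k < n.*2.+1) (k <= l) <= l.
  rewrite -big_mkcond /= sum1_count.
  have [hl|hl] := leqP l n.*2.
    rewrite /index_iota subn1 /= (_ : n.*2 = l + (n.*2 - l)); last by rewrite subnKC.
    rewrite iotaD count_cat (@eq_in_count _ _ pred0 (iota (1 + l) _)).
      by rewrite count_pred0 addn0; apply: leq_trans (count_size _ _) _; rewrite size_iota.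
    by move=> x; rewrite mem_iota => /andP[h _] /=; lia.
  by apply: leq_trans (count_size _ _) _; rewrite size_iota; lia.
rewrite -(leq_add2r (logn p n`! + logn p n`!)) -hf logn_fact // e1 -big_split /=.
apply: leq_trans (_ : _ <= \sum_(1 <= k < n.*2.+1)
    ((k <= l) + (n %/ p ^ k + n %/ p ^ k))) _; last first.
  by rewrite big_split leq_add2r.
rewrite !big_nat; apply: leq_sum => k hk.
have pk : 0 < p ^ k by rewrite expn_gt0 prime_gt0.
case: (leqP k l) => hkl.
  rewrite -ltnS ltn_divLR // -addnn.
  have := divn_eq n (p ^ k); have := ltn_pmod n pk.
  by move: (n %/ _) (n %% _) => x y hb1 ->; nia.
rewrite divn_small //.
by apply: leq_trans (trunc_log_ltn n.*2 p1) _; rewrite leq_exp2l.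
Qed.

(** Chebyshev's lower bound: [C(2n, n) >= 2^n] is a product of prime powers,
    each of them at most [2n]. *)
Lemma chebyshev_lower s : 0 < s -> 2 ^ s.-1 <= s * size (primes_in 0 (2 ^ s)).
Proof.
case: s => // s _ /=; set n := 2 ^ s.
have n0 : 0 < n by rewrite expn_gt0.
have e2 : 2 ^ s.+1 = n.*2 by rewrite expnS mul2n.
rewrite -(@leq_exp2l 2) // (leq_trans (expn2_le_bin n)) // expnM !e2.
have b0 : 0 < 'C(n.*2, n) by rewrite bin_gt0 -addnn leq_addr.
rewrite -[X in X <= _](partnT b0) (@widen_partn (maxn n.*2 'C(n.*2, n))) ?leq_maxr //.
set M := maxn _ _; set F := BIG_F.
have hF p : prime p -> F p <= n.*2 by move=> pp; apply: expn_logn_bin.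
have F1 p : p \notin primes_in 0 n.*2 -> F p = 1.
  rewrite mem_primes_in /F => hp.
  have [pp|np] := boolP (prime p); last by rewrite lognE (negbTE np).
  rewrite (_ : logn p _ = 0) ?expn0 //; apply/eqP; rewrite -leqn0 leqNgt.
  apply/negP => h; move: hp; rewrite pp prime_gt0 //= => /negP; apply.
  by apply: leq_trans (expn_logn_bin pp n0); rewrite -[X in X <= _]expn1 leq_exp2l ?prime_gt1.
rewrite (bigID (fun p => p \in primes_in 0 n.*2)) /= [X in _ * X]big1 ?muln1; last first.
  by move=> p /F1.
rewrite -big_filter.
apply: (@leq_trans (\prod_(i <- primes_in 0 n.*2) F i)).
  apply: eq_leq; apply: perm_big; apply: uniq_perm.
  - by rewrite filter_uniq ?iota_uniq.
  - exact: uniq_primes_in.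
  move=> p; rewrite mem_filter mem_index_iota.
  apply: andb_idr; rewrite mem_primes_in => /and3P[_ _ h].
  by rewrite ltnS leq0n /= (leq_trans h) ?leq_maxl.
have: all prime (primes_in 0 n.*2) by apply/allP => p; rewrite mem_primes_in => /and3P[].
elim: (primes_in _ _) => [|p r IH] /=; first by rewrite big_nil.
by case/andP=> pp /IH{}IH; rewrite big_cons expnS leq_mul ?hF.
Qed.

Lemma primes_in_lower s a : 0 < s -> 2 ^ s.-1 <= s * (a + size (primes_in a (2 ^ s))).
Proof.
move=> s0; apply: leq_trans (chebyshev_lower s0) _.
by rewrite leq_mul2l size_primes_in0 orbT.
Qed.

Local Open Scope ring_scope.

Lemma primes_in_cat a b c : (a <= b)%N -> (b <= c)%N ->
  primes_in a c = primes_in a b ++ primes_in b c.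
Proof.
move=> ab bc; rewrite /primes_in -filter_cat (_ : (c - a = (b - a) + (c - b))%N); last lia.
by rewrite iotaD; congr (filter _ (_ ++ iota _ _)); lia.
Qed.

Lemma ler_size_sum (T : eqType) (r : seq T) (f : T -> rat) (c : rat) :
  {in r, forall x, c <= f x} -> (size r)%:R * c <= \sum_(x <- r) f x.
Proof.
elim: r => [|x r IH] h /=; first by rewrite big_nil mul0r.
rewrite big_cons -natr1 mulrDl mul1r addrC lerD //; first by apply: h; rewrite inE eqxx.
by apply: IH => y hy; apply: h; rewrite inE hy orbT.
Qed.

Lemma ler_sum_size (T : eqType) (r : seq T) (f : T -> rat) (c : rat) :
  {in r, forall x, f x <= c} -> \sum_(x <- r) f x <= (size r)%:R * c.
Proof.
move=> h; have := @ler_size_sum _ r (fun x => - f x) (- c).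
rewrite sumrN mulrN lerN2; apply => x hx; rewrite lerN2; exact: h.
Qed.

Lemma harmonic_lower n : n%:R / 2 <= \sum_(1 <= j < 2 ^ n) j%:R^-1 + 1 / 2 :> rat.
Proof.
elim: n => [|n IH]; first by rewrite big_geq // ; lra.
have n2 : (0 < 2 ^ n)%N by rewrite expn_gt0.
rewrite (@big_cat_nat _ _ _ (2 ^ n)) //=; last by rewrite leq_exp2l.
suff : 2^-1 <= \sum_(2 ^ n <= i < 2 ^ n.+1) i%:R^-1 :> rat by lra.
have := @ler_size_sum _ (index_iota (2 ^ n) (2 ^ n.+1)) (fun i => i%:R^-1) ((2 ^ n.+1)%:R^-1).
rewrite size_iota (_ : 2 ^ n.+1 - 2 ^ n = 2 ^ n)%N; last by rewrite expnS; lia.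
have -> : (2 ^ n)%:R * (2 ^ n.+1)%:R^-1 = 2^-1 :> rat.
  by rewrite expnS natrM; field; rewrite pnatr_eq0 expn_eq0.
apply=> i; rewrite mem_index_iota => /andP[h1 h2].
rewrite lef_pV2 ?posrE ?ltr0n ?expn_gt0 ?ler_nat //; [exact: ltnW|lia].
Qed.

(** Abel summation over dyadic blocks turns the bound [pi(2^j) >= 2^(j-1) / j]
    into the harmonic series. *)
Lemma sum_inv_primes_lower s :
  \sum_(1 <= j < s) j%:R^-1 / 4 <= \sum_(p <- primes_in 0 (2 ^ s)) p%:R^-1 :> rat.
Proof.
pose c j : rat := (size (primes_in 0 (2 ^ j)))%:R.
have c_ge j : (0 < j)%N -> j%:R^-1 / 4 <= c j / (2 ^ j.+1)%:R.
  move=> j0; have := chebyshev_lower j0.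
  rewrite -(ler_nat rat) natrM -/(c j) (_ : 2 ^ j.+1 = 4 * 2 ^ j.-1)%N; last first.
    by case: j j0 => // j _; rewrite /= !expnS !mulnA.
  rewrite natrM; have : 0 < j%:R :> rat by rewrite ltr0n.
  have : 0 < (2 ^ j.-1)%:R :> rat by rewrite ltr0n expn_gt0.
  move: (j%:R) ((2 ^ j.-1)%:R) (c j) => x y z y0 x0 h.
  rewrite ler_pdivlMr ?mulr_gt0 // (_ : _ * _ = y / x); last by field; rewrite lt0r_neq0.
  by rewrite ler_pdivrMr // mulrC.
suff : c s / (2 ^ s)%:R + \sum_(0 <= j < s) c j / (2 ^ j.+1)%:R <=
    \sum_(p <- primes_in 0 (2 ^ s)) p%:R^-1.
  apply: le_trans; apply: ler_wpDl; first by rewrite divr_ge0.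
  case: s => [|s]; first by rewrite !big_geq.
  rewrite [X in _ <= X]big_ltn //; apply: ler_wpDl; first by rewrite divr_ge0.
  by rewrite !big_nat; apply: ler_sum => j /andP[/c_ge].
elim: s => [|s IH].
  rewrite big_geq // addr0; apply: ler_size_sum => p; rewrite mem_primes_in => /and3P[pp h0 h1].
  by move: (prime_gt1 pp); lia.
rewrite big_nat_recr //= (@primes_in_cat 0 (2 ^ s)) ?leq_exp2l // big_cat /=.
have h : (c s.+1 - c s) / (2 ^ s.+1)%:R <= \sum_(p <- primes_in (2 ^ s) (2 ^ s.+1)) p%:R^-1.
  rewrite /c (@primes_in_cat 0 (2 ^ s) (2 ^ s.+1)) ?leq_exp2l // size_cat natrD addrAC subrr add0r.
  apply: ler_size_sum => p; rewrite mem_primes_in => /and3P[pp h0 h1].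
  by rewrite lef_pV2 ?posrE ?ltr0n ?expn_gt0 ?ler_nat ?prime_gt0.
have e : c s / (2 ^ s)%:R = 2 * (c s / (2 ^ s.+1)%:R) :> rat.
  rewrite expnS natrM; field; by rewrite pnatr_eq0 expn_eq0.
move: IH h; rewrite e mulrBl; lra.
Qed.

Lemma sum_inv_primes_diverges a (x : rat) :
  exists s0, forall s, (s0 <= s)%N -> x <= \sum_(p <- primes_in a (2 ^ s)) p%:R^-1.
Proof.
pose n := Num.truncn (8 * (`|x| + a%:R + 1)).
exists (maxn a (2 ^ n.+1)) => s; rewrite geq_max => /andP[sa sn].
have as2 : (a <= 2 ^ s)%N by apply: leq_trans sa (ltnW (ltn_expl _ _)).
have := sum_inv_primes_lower s; rewrite (@primes_in_cat 0 a) // big_cat /=.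
have h1 : \sum_(p <- primes_in 0 a) p%:R^-1 <= a%:R :> rat.
  apply: (@le_trans _ _ ((size (primes_in 0 a))%:R * 1)).
    apply: ler_sum_size => p; rewrite mem_primes_in => /and3P[pp _ _].
    by rewrite invf_le1 ?ltr0n ?prime_gt0 // ler1n prime_gt0.
  by rewrite mulr1 ler_nat; have := size_primes_in0 a a; rewrite {2}/primes_in subnn addn0.
have h2 : \sum_(1 <= j < 2 ^ n.+1) j%:R^-1 <= \sum_(1 <= j < s) j%:R^-1 :> rat.
  rewrite [X in _ <= X](@big_cat_nat _ _ _ (2 ^ n.+1)) ?expn_gt0 //=.
  by rewrite lerDl; apply: sumr_ge0 => i _; rewrite invr_ge0 ler0n.
have h3 : 8 * (`|x| + a%:R + 1) < n.+1%:R :> rat by apply: real_truncnS_gt; apply: num_real.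
have := harmonic_lower n.+1.
rewrite -mulr_suml; move: h1 h2 h3 (ler_norm x).
set A := \sum_(_ <- _) _; set B := \sum_(_ <= _ < _) _; set C := \sum_(_ <= _ < _) _.
set D := \sum_(_ <- _) _; lra.
Qed.

(** * The Cauchy-Davenport inequality *)
Lemma Fp_stable_setT p (A : {set 'F_p}) (d : 'F_p) : prime p -> A != set0 -> d != 0 ->
  (forall a, a \in A -> a + d \in A) -> A = setT.
Proof.
move=> pp /set0Pn[a aA] d0 h; apply/setP => y; rewrite in_setT.
have hn n : a + n%:R * d \in A.
  by elim: n => [|n IH]; rewrite ?mul0r ?addr0 // -natr1 mulrDl mul1r addrA h.
have := hn (val ((y - a) / d)); rewrite natr_Zp.
by rewrite divfK // addrC subrK.
Qed.

(** Dyson's transform [A :|: (B + e)], [B :&: (A - e)] keeps the sum of the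
    cardinals and shrinks both the sumset and [B]. *)
Lemma cauchy_davenport p (A B : {set 'F_p}) : prime p -> A != set0 -> B != set0 ->
  (minn p (#|A| + #|B|).-1 <= #|[set (a + b)%R | a in A, b in B]|)%N.
Proof.
move=> pp; have [n] := ubnP #|B|; elim: n A B => // n IH A B ltBn A0 B0.
have addI (e : 'F_p) : injective (fun x => x + e) by move=> x y /addIr.
have leA b : b \in B -> (#|A| <= #|[set (a + b)%R | a in A, b in B]|)%N.
  move=> bB; rewrite -(card_imset A (addI b)); apply: subset_leq_card.
  by apply/subsetP => _ /imsetP[a aA ->]; apply: imset2_f.
have [|B1] := leqP #|B| 1.
  move=> B1; have [b bB] := set0Pn _ B0.
  have := leA b bB; have : (0 < #|B|)%N by rewrite card_gt0.
  lia.
have [b1 [b2 [b1B b2B b12]]] : exists b1 b2, [/\ b1 \in B, b2 \in B & b1 != b2].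
  have [b bB] := set0Pn _ B0.
  have : (0 < #|B :\ b|)%N by move: B1; rewrite (cardsD1 b) bB.
  by rewrite card_gt0 => /set0Pn[c]; rewrite !inE => /andP[cb cB]; exists c, b.
have d0 : b2 - b1 != 0 by rewrite subr_eq0 eq_sym.
have [/forallP hA|] := boolP [forall a in A, a + (b2 - b1) \in A].
  have AT : A = setT.
    by apply: (Fp_stable_setT pp A0 d0) => a aA; have /implyP := hA a; apply.
  by have := leA _ b1B; rewrite AT cardsT card_Fp // => h; apply: leq_trans h; rewrite geq_minl.
rewrite negb_forall => /existsP[a]; rewrite negb_imply => /andP[aA aNA].
(* [a] is in [A] but [a + (b2 - b1)] is not: the shift [e] keeps [b1] in [B'] and removes [b2]. *)
pose e := a - b1.
pose A' := A :|: [set b + e | b in B]; pose B' := [set b in B | b + e \in A].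
have b1B' : b1 \in B' by rewrite inE b1B /e addrC subrK.
have b2B' : b2 \notin B' by rewrite inE b2B /e /= (_ : b2 + _ = a + (b2 - b1)) //; ring.
have card' : (#|A'| + #|B'| = #|A| + #|B|)%N.
  have e1 : #|[set b + e | b in B] :\: A| = #|B :\: B'|.
    rewrite -(card_imset (B :\: B') (addI e)); apply: eq_card => x.
    rewrite !inE; apply/andP/imsetP => [[xA /imsetP[b bB xb]]|[b]].
      by exists b => //; rewrite !inE bB -xb xA.
    by rewrite !inE => /andP[h bB] ->; rewrite bB /= in h; split=> //; apply: imset_f.
  have e2 : B :&: B' = B' by apply/setIidPr/subsetP => x; rewrite inE => /andP[].
  have -> : #|A'| = (#|A| + #|B :\: B'|)%N.
    rewrite -e1 /A' -(cardsID A (A :|: _)) setUK; congr (_ + _)%N.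
    by rewrite setDUl setDv set0U.
  by rewrite -addnA [(#|_ :\: _| + _)%N]addnC -{1}e2 cardsID.
have ltB : (#|B'| < n)%N.
  apply: leq_trans (_ : #|B| <= n)%N; last by [].
  apply: proper_card; apply/properP; split; last by exists b2.
  by apply/subsetP => x; rewrite inE => /andP[].
have := IH A' B' ltB; rewrite card'.
have -> : A' != set0 by have [x xA] := set0Pn _ A0; apply/set0Pn; exists x; rewrite inE xA.
have -> : B' != set0 by apply/set0Pn; exists b1.
move=> /(_ isT isT) h; apply: leq_trans h _; apply: subset_leq_card.
apply/subsetP => _ /imset2P[x b xA' bB' ->].
move: bB'; rewrite inE => /andP[bB beA].
move: xA'; rewrite inE => /orP[xA|/imsetP[b' b'B ->]]; first by apply: imset2_f.
by rewrite (_ : b' + e + b = (b + e) + b'); [apply: imset2_f | ring].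
Qed.

(** * Sums of reciprocals of primes modulo a prime *)

Definition complete (q : nat) (H : seq nat) : Prop :=
  forall t : 'F_q, exists2 D, subseq D H & \sum_(r <- D) (r%:R : 'F_q)^-1 = t.

(** Counting the sub-lists with a given sum, instead of collecting the sums, gives access
    to second moments. *)
Fixpoint nsub (q : nat) (H : seq nat) : 'F_q -> nat :=
  if H is a :: H' then fun x => (nsub H' x + nsub H' (x - a%:R^-1)%R)%N
  else fun x => (x == 0 : nat).

(** The number of pairs of sub-lists with the same sum: few coincidences mean many sub-sums. *)
Definition energy (q : nat) (H : seq nat) : nat := (\sum_(x : 'F_q) nsub H x ^ 2)%N.

Definition subsums (q : nat) (H : seq nat) : {set 'F_q} := [set x | (0 < nsub H x)%N].

Lemma subsumsP q H (x : 'F_q) :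
  reflect (exists2 D, subseq D H & \sum_(r <- D) (r%:R : 'F_q)^-1 = x) (x \in subsums q H).
Proof.
rewrite inE; apply: (iffP idP).
  elim: H x => [|a H IH] x /=.
    by case: eqP => // -> _; exists [::]; rewrite ?big_nil.
  rewrite addn_gt0 => /orP[] /IH[D sD eD].
    by exists D => //; apply: subseq_trans sD (subseq_cons _ _).
  by exists (a :: D); rewrite /= ?eqxx // big_cons eD addrC subrK.
case=> D; elim: H D x => [|a H IH] D x /=.
  by move/eqP => -> <-; rewrite big_nil eqxx.
case: D => [|b D] /=.
  by move=> _ <-; rewrite big_nil addn_gt0 (IH [::]) ?sub0seq ?big_nil.
case: eqP => [->|_] sD eD; rewrite addn_gt0.
  by rewrite (IH D (x - a%:R^-1)) ?orbT // -eD big_cons addrAC subrr add0r.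
by rewrite (IH (b :: D) x).
Qed.

Lemma completeP q H : prime q -> (q <= #|subsums q H|)%N -> complete q H.
Proof.
move=> pq hq t; apply/subsumsP; suff -> : subsums q H = setT by rewrite in_setT.
by apply/eqP; rewrite eqEcard subsetT cardsT card_Fp.
Qed.

Lemma sum_shift q (f : 'F_q -> nat) (c : 'F_q) :
  (\sum_(x : 'F_q) f (x - c)%R = \sum_(x : 'F_q) f x)%N.
Proof. by rewrite [RHS](reindex_inj (addIr (- c))). Qed.

Lemma sum_nsub q H : (\sum_(x : 'F_q) nsub H x = 2 ^ size H)%N.
Proof.
elim: H => [|a H IH] /=; last by rewrite big_split /= sum_shift IH addnn -mul2n expnS.
by rewrite -big_mkcond /= big_pred1_eq.
Qed.

Lemma energy_cons q a H : (energy q (a :: H) = 2 * energy q H +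
   2 * \sum_(x : 'F_q) nsub H x * nsub H (x - a%:R^-1)%R)%N.
Proof.
rewrite /energy /= mul2n -addnn -[X in (_ + X + _)%N](sum_shift _ a%:R^-1) -big_split /=.
rewrite big_distrr -big_split; apply: eq_bigr => x _ /=.
by rewrite sqrnD.
Qed.

Lemma leq_sum_uniq (T : finType) (s : seq T) (f : T -> nat) :
  uniq s -> (\sum_(x <- s) f x <= \sum_x f x)%N.
Proof. by move=> us; rewrite big_uniq //= [X in (_ <= X)%N](bigID (mem s)) leq_addr. Qed.

Lemma Fp_nat_inj q a b : prime q -> (a < q)%N -> (b < q)%N -> a%:R = b%:R :> 'F_q -> a = b.
Proof.
move=> pq aq bq /(congr1 val); rewrite /= !val_Fp_nat //.
by rewrite !modn_small.
Qed.

(** The reciprocals of the members of [A] are distinct modulo [q], so each pair of sub-sums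
    is counted for at most one of them. *)
Lemma sum_correlation q (A H : seq nat) : prime q -> uniq A -> {in A, forall a, a < q}%N ->
  (\sum_(a <- A) \sum_(x : 'F_q) nsub H x * nsub H (x - a%:R^-1)%R <= 4 ^ size H)%N.
Proof.
move=> pq uA hA; rewrite exchange_big /= -[4%N]/(2 * 2)%N expnMn -{1}(sum_nsub q H) big_distrl /=.
apply: leq_sum => x _; rewrite -big_distrr leq_mul2l; apply/orP; right.
rewrite -(sum_nsub q H) -(big_map (fun a : nat => x - a%:R^-1) xpredT (nsub H)).
apply: leq_sum_uniq; rewrite map_inj_in_uniq // => a b aA bA /addrI/oppr_inj/invr_inj.
by apply: Fp_nat_inj => //; apply: hA.
Qed.

(** The second moment method, linearized by [2 u v <= u^2 + v^2] so that the bounds of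
    several lists can be added. *)
Lemma card_subsums_lower q H k :
  (8 * k * 4 ^ size H <= 16 * 4 ^ size H * #|subsums q H| + k ^ 2 * energy q H)%N.
Proof.
set s := size H.
have e4 : (4 ^ s = 2 ^ s * 2 ^ s)%N by rewrite -expnMn.
have -> : (8 * k * 4 ^ s = \sum_(x in subsums q H) 2 * ((4 * 2 ^ s) * (k * nsub H x)))%N.
  transitivity (\sum_(x : 'F_q) 8 * k * 2 ^ s * nsub H x)%N.
    by rewrite -big_distrr /= sum_nsub e4 mulnA.
  rewrite [RHS]big_mkcond; apply: eq_bigr => x _; rewrite inE lt0n.
  by case: eqP => [->|_] /=; lia.
apply: (@leq_trans (\sum_(x in subsums q H) ((4 * 2 ^ s) ^ 2 + (k * nsub H x) ^ 2))%N).
  by apply: leq_sum => x _; apply: nat_Cauchy.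
rewrite big_split sum_nat_const /=; apply: leq_add; first by rewrite e4; lia.
rewrite /energy big_distrr [X in (_ <= X)%N](bigID [in subsums q H]) /=.
by apply: leq_trans (leq_addr _ _); apply: leq_sum => x _; rewrite expnMn.
Qed.

Lemma card_subsums_gt0 q H : (0 < #|subsums q H|)%N.
Proof.
rewrite card_gt0; apply/set0Pn; exists 0; apply/subsumsP.
by exists [::]; rewrite ?sub0seq ?big_nil.
Qed.

Lemma card_subsums_cat q H H' : prime q ->
  (minn q (#|subsums q H| + #|subsums q H'|).-1 <= #|subsums q (H ++ H')|)%N.
Proof.
move=> pq.
have n0 G : subsums q G != set0 by rewrite -card_gt0 card_subsums_gt0.
apply: leq_trans (cauchy_davenport pq (n0 H) (n0 H')) _.
apply: subset_leq_card; apply/subsetP => _ /imset2P[x y /subsumsP[D sD <-] /subsumsP[D' sD' <-] ->].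
by apply/subsumsP; exists (D ++ D'); rewrite ?cat_subseq ?big_cat.
Qed.

Lemma card_subsums_flatten q Hs : prime q ->
  (minn q (\sum_(H <- Hs) #|subsums q H|.-1).+1 <= #|subsums q (flatten Hs)|)%N.
Proof.
move=> pq; elim: Hs => [|H Hs IH] /=.
  by rewrite big_nil; apply: leq_trans (geq_minr _ _) (card_subsums_gt0 _ _).
rewrite big_cons.
have := card_subsums_cat H (flatten Hs) pq; have := card_subsums_gt0 q H.
by move: IH; move: #|_| #|_| #|_| (\sum_(_ <- _) _)%N => a b c d; lia.
Qed.

Lemma exists_le_average (T : eqType) (s : seq T) (f : T -> nat) k X :
  (0 < k)%N -> (k <= size s)%N -> (\sum_(x <- s) f x <= X)%N ->
  exists2 x, x \in s & (k * f x <= X)%N.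
Proof.
move=> k0 ks hX.
case: (boolP (has (fun x => k * f x <= X)%N s)) => [/hasP[x xs hx]|]; first by exists x.
move/hasPn => h.
suff : (size s * X.+1 <= k * \sum_(x <- s) f x)%N by nia.
elim: {ks hX} s h => [|x s IH] h; first by rewrite big_nil.
rewrite big_cons /= mulSn mulnDr leq_add //.
  by rewrite ltnNge h // mem_head.
by apply: IH => y ys; apply: h; rewrite inE ys orbT.
Qed.

Lemma size_avoid (T : eqType) (A H : seq T) : uniq A ->
  (size A <= size H + size [seq a <- A | a \notin H])%N.
Proof.
move=> uA; rewrite -(count_predC (mem H) A) size_filter leq_add2r -size_filter.
apply: uniq_leq_size; first by rewrite filter_uniq.
by move=> x; rewrite mem_filter => /andP[].
Qed.

(** The primes are chosen one after the other: by [sum_correlation] an average choice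
    creates few new coincidences, summed over all the moduli of [Q]. *)
Lemma low_energy_block (Q A : seq nat) k i : (0 < k)%N ->
  {in Q, forall q, prime q /\ {in A, forall a, a < q}%N} ->
  uniq A -> (k + i <= size A)%N ->
  exists H, [/\ uniq H, {subset H <= A}, size H = i &
    (k * (\sum_(q <- Q) energy q H) <= size Q * (k * 2 ^ i + 4 ^ i))%N].
Proof.
move=> k0 hQ uA; elim: i => [|i IH] sA.
  exists [::]; split=> //.
  rewrite (eq_bigr (fun=> 1%N)); first by rewrite sum1_size; nia.
  by move=> q _; rewrite /energy -[RHS]/(2 ^ size (@nil nat))%N -(sum_nsub q); apply: eq_bigr => x _ /=; case: eqP.
have [|H [uH sHA eH hH]] := IH; first lia.
pose A' := [seq a <- A | a \notin H].
have sA' : (k <= size A')%N.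
  by have : (size A <= size H + size A')%N := size_avoid H uA; rewrite eH; lia.
have hA' : (\sum_(a <- A') \sum_(q <- Q) \sum_(x : 'F_q) nsub H x * nsub H (x - a%:R^-1)%R
   <= size Q * 4 ^ i)%N.
  rewrite exchange_big /= -sum1_size big_distrl /= !big_seq; apply: leq_sum => q qQ.
  have [pq hq] := hQ q qQ; rewrite mul1n -eH; apply: sum_correlation => //.
    by rewrite filter_uniq.
  by move=> a; rewrite mem_filter => /andP[_ /hq].
have [a aA' ha] := exists_le_average k0 sA' hA'.
move: aA'; rewrite mem_filter => /andP[aH aA].
exists (a :: H); split; rewrite /= ?aH ?uH ?eH //.
  by move=> x; rewrite inE => /orP[/eqP->|/sHA].
under eq_bigr do rewrite energy_cons.
rewrite big_split -!big_distrr /= !expnS.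
by move: hH ha; set E := (\sum_(_ <- _) _)%N; set F := (\sum_(_ <- _) _)%N; nia.
Qed.

Lemma low_energy_blocks (Q A : seq nat) k i j : (0 < k)%N ->
  {in Q, forall q, prime q /\ {in A, forall a, a < q}%N} ->
  uniq A -> (k + i * j <= size A)%N ->
  exists Hs, [/\ uniq (flatten Hs), {subset flatten Hs <= A}, size (flatten Hs) = (i * j)%N,
    size Hs = j /\ {in Hs, forall H, size H = i} &
    (\sum_(H <- Hs) k * (\sum_(q <- Q) energy q H) <= j * (size Q * (k * 2 ^ i + 4 ^ i)))%N].
Proof.
move=> k0 hQ uA; elim: j => [|j IH] sA.
  by exists [::]; split => //=; rewrite ?muln0 ?big_nil //; split.
have [|Hs [uH sHA eH [jH iH] hH]] := IH; first by rewrite mulnS in sA; lia.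
pose A' := [seq a <- A | a \notin flatten Hs].
have sA' : (k + i <= size A')%N.
  have : (size A <= size (flatten Hs) + size A')%N := size_avoid (flatten Hs) uA.
  by rewrite eH; rewrite mulnS in sA; lia.
have [||H [uH' sH' eH' hH']] := @low_energy_block Q A' k i k0 _ _ sA'.
- move=> q /hQ[pq hq]; split=> // a; rewrite mem_filter => /andP[_]; exact: hq.
- by rewrite filter_uniq.
exists (H :: Hs); split => //=.
- rewrite cat_uniq uH' uH andbT /=; apply/hasPn => x xHs; apply/negP => /sH'.
  by rewrite mem_filter xHs.
- move=> x; rewrite mem_cat => /orP[/sH'|/sHA] //; by rewrite mem_filter => /andP[].
- by rewrite size_cat eH eH' mulnS.
- by split; [rewrite jH | move=> G; rewrite inE => /orP[/eqP->|/iH]].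
by rewrite big_cons mulSn leq_add.
Qed.

(** Each block of [s] primes has about [k] sub-sums for an average modulus. By Markov's
    inequality the total energy of the [j] blocks is at most twice its mean for half of the
    moduli, and for these Cauchy-Davenport adds the blocks up to everything. *)
Lemma exists_complete (Q A : seq nat) k s j : (8 <= k <= 2 ^ s)%N ->
  {in Q, forall q, [/\ prime q, (8 * q <= k * j)%N & {in A, forall a, a < q}%N]} ->
  uniq A -> (k + s * j <= size A)%N ->
  exists H Q', [/\ uniq H, {subset H <= A}, size H = (s * j)%N &
    [/\ subseq Q' Q, (size Q <= 2 * size Q')%N & {in Q', forall q, complete q H}]].
Proof.
case/andP=> k8 ks hQ uA sA.
have [||Hs [uH sHA eH [jH iH] hH]] := @low_energy_blocks Q A k s j _ _ uA sA; first lia.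
  by move=> q /hQ[].
pose en q := (\sum_(H <- Hs) k * energy q H)%N.
have e4 : (4 ^ s = 2 ^ s * 2 ^ s)%N by rewrite -expnMn.
have n4 : (0 < 4 ^ s)%N by rewrite expn_gt0.
exists (flatten Hs), [seq q <- Q | en q <= 4 * j * 4 ^ s]%N; split=> //; split.
- exact: filter_subseq.
- have {}hH : (\sum_(q <- Q) en q <= 2 * j * 4 ^ s * size Q)%N.
    rewrite /en exchange_big /=; under eq_bigr do rewrite -big_distrr.
    apply: leq_trans hH _.
    rewrite (_ : 2 * j * 4 ^ s * size Q = j * (size Q * (4 ^ s + 4 ^ s)))%N; last lia.
    by rewrite !leq_mul2l leq_add2r e4 leq_mul2r ks !orbT.
  case: (posnP j) => [j0|j0].
    case: (Q) hQ => // q Q' /(_ q (mem_head _ _)) [pq h _].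
    by have := prime_gt0 pq; rewrite j0 in h; lia.
  pose P q := (en q <= 4 * j * 4 ^ s)%N; rewrite size_filter -/P.
  have eP : (count P Q + count (predC P) Q)%N = size Q := count_predC P Q.
  suff : (4 * j * 4 ^ s * count (predC P) Q <= \sum_(q <- Q) en q)%N.
    move=> h; have {hH}h := leq_trans h hH.
    suff : (2 * count (predC P) Q <= size Q)%N by rewrite -eP; move: (count P Q) (count _ Q) => x y; lia.
    have c0 : (0 < 2 * j * 4 ^ s)%N by rewrite !muln_gt0 j0.
    rewrite -(leq_pmul2l c0); apply: leq_trans h.
    by rewrite (_ : 4 * j * 4 ^ s = 2 * j * 4 ^ s * 2)%N ?mulnA //; lia.
  elim: (Q) => [|q Q' IH] /=; first by rewrite muln0.
  rewrite big_cons mulnDr leq_add //.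
  case hP: (P q); first by rewrite muln0.
  by rewrite [nat_of_bool _]/= muln1 ltnW // ltnNge; apply/negP => hle; rewrite /P hle in hP.
move=> q; rewrite mem_filter => /andP[hq /hQ[pq jq _]]; apply: completeP => //.
apply: leq_trans (card_subsums_flatten Hs pq); rewrite leq_min leqnn /=.
suff h : (k * j <= 4 * \sum_(H <- Hs) #|subsums q H|)%N.
  have h2 : (\sum_(H <- Hs) #|subsums q H| = \sum_(H <- Hs) #|subsums q H|.-1 + j)%N.
    rewrite -jH -sum1_size -big_split /=; apply: eq_bigr => H _.
    by rewrite addn1 prednK ?card_subsums_gt0.
  have h3 : (8 * j <= k * j)%N by rewrite leq_mul2r k8 orbT.
  move: h h3 jq; rewrite h2; move: (k * j)%N (\sum_(_ <- _) _)%N => x y; lia.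
have : (\sum_(H <- Hs) 8 * k * 4 ^ s <= \sum_(H <- Hs)
    (16 * 4 ^ s * #|subsums q H| + k * (k * energy q H)))%N.
  rewrite !big_seq; apply: leq_sum => H /iH <-.
  by apply: leq_trans (card_subsums_lower q H k) _; rewrite mulnA.
rewrite big_split /= -!big_distrr /= -/(en q) big_const_seq count_predT jH iter_addn_0.
move: (\sum_(_ <- _) _)%N => S h.
rewrite -(@leq_pmul2l (4 * 4 ^ s)); last by rewrite muln_gt0.
have := leq_mul (leqnn k) hq; rewrite /en -big_distrr /=.
move: h; move: (\sum_(_ <- _) _)%N (4 ^ s)%N => E X; nia.
Qed.

(** * Sums of edges *)

Definition egyptian (E : nat -> Prop) (v : rat) : Prop :=
  exists s : seq nat, [/\ uniq s, {in s, forall n, E n} & v = \sum_(n <- s) n%:R^-1].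

Lemma egyptian0 E : egyptian E 0.
Proof. by exists [::]; rewrite big_nil. Qed.

Lemma egyptian_sub (E E' : nat -> Prop) v : (forall n, E n -> E' n) -> egyptian E v -> egyptian E' v.
Proof. by move=> sE [s [us hs ->]]; exists s; split=> // n /hs /sE. Qed.

Lemma egyptianD (E E' : nat -> Prop) v v' : (forall n, E n -> ~ E' n) ->
  egyptian E v -> egyptian E' v' -> egyptian (fun n => E n \/ E' n) (v + v').
Proof.
move=> dE [s [us hs ->]] [s' [us' hs' ->]]; exists (s ++ s'); split.
- rewrite cat_uniq us us' andbT; apply/hasPn => n /hs' h'; apply/negP => /hs h; exact: dE h h'.
- by move=> n; rewrite mem_cat => /orP[/hs|/hs']; [left|right].
- by rewrite big_cat.
Qed.

Definition star (C : seq nat) (P n : nat) : Prop := exists2 r, r \in C & n = (r * P)%N.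

Lemma egyptian_star C P D : (0 < P)%N -> uniq D -> {subset D <= C} ->
  egyptian (star C P) (\sum_(r <- D) (r * P)%:R^-1).
Proof.
move=> P0 uD sD; exists [seq (r * P)%N | r <- D]; split; last by rewrite big_map.
  by rewrite map_inj_uniq // => a b /eqP; rewrite eqn_pmul2r // => /eqP.
by move=> _ /mapP[r rD ->]; exists r; rewrite ?sD.
Qed.

Lemma semiprime_inj p q p' q' : prime p -> prime q -> prime p' -> prime q' ->
  (p * q = p' * q')%N -> (p = p' /\ q = q') \/ (p = q' /\ q = p').
Proof.
move=> pp pq pp' pq' e.
have : (p %| p' * q')%N by rewrite -e dvdn_mulr.
rewrite Euclid_dvdM // !dvdn_prime2 // => /orP[] /eqP h.
  left; split=> //; apply/eqP; rewrite -(eqn_pmul2l (prime_gt0 pp)) e h; exact: eqxx.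
right; split=> //; apply/eqP; rewrite -(eqn_pmul2l (prime_gt0 pp)) e h mulnC; exact: eqxx.
Qed.

(** * Integrality of sums of edges *)

Lemma natr_cofactors (F : fieldType) (D : seq nat) m :
  {in D, forall r, (r %| m)%N /\ r%:R != 0 :> F} ->
  (\sum_(r <- D) m %/ r)%:R = m%:R * \sum_(r <- D) r%:R^-1 :> F.
Proof.
move=> hD; rewrite natr_sum mulr_sumr !big_seq; apply: eq_bigr => r /hD[/dvdnP[k ->] r0].
by rewrite natrM mulfK // mulnK // lt0n; apply: contraNneq r0 => ->.
Qed.

Lemma Fp_natr_eq0 q n : prime q -> (n%:R == 0 :> 'F_q) = (q %| n)%N.
Proof. by move=> pq; rewrite -(dvdn_pcharf (pchar_Fp pq)). Qed.

(** The edges between [q] and [D] add up to a number without [q] in its denominator, after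
    subtraction of [x / (m q)], when the reciprocals of [D] have the right sum modulo [q]. *)
Lemma int_div_balanced q (D : seq nat) m (x : int) : prime q ->
  {in D, forall r, (r %| m)%N /\ ~~ (q %| r)%N} ->
  x%:~R = m%:R * \sum_(r <- D) r%:R^-1 :> 'F_q ->
  x%:~R / q%:R - m%:R * \sum_(r <- D) (r * q)%:R^-1 \is a @Num.int rat.
Proof.
move=> pq hD hx; have q0 : q%:R != 0 :> rat by rewrite pnatr_eq0 -lt0n prime_gt0.
have hq : (q%:Z %| x - (\sum_(r <- D) m %/ r)%N%:Z)%Z.
  rewrite (dvdz_pcharf (pchar_Fp pq)) rmorphB /= hx -pmulrn natr_cofactors ?subrr //.
  by move=> r /hD[rm qr]; rewrite Fp_natr_eq0.
have /dvdzP[z /eqP] := hq; rewrite subr_eq => /eqP ->.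
suff -> : m%:R * \sum_(r <- D) (r * q)%:R^-1 = (\sum_(r <- D) m %/ r)%N%:R / q%:R :> rat.
  by rewrite rmorphD rmorphM /= -!pmulrn mulrDl mulfK // addrK intr_int.
rewrite natr_cofactors; last first.
  move=> r /hD[rm qr]; split=> //; rewrite pnatr_eq0; apply: contraNneq qr => ->; exact: dvdn0.
rewrite -mulrA; congr (_ * _); rewrite mulr_suml.
by apply: eq_bigr => r _; rewrite natrM invfM.
Qed.

Definition prodl (L : seq nat) : nat := (\prod_(p <- L) p)%N.

Lemma prodl_gt0 L : all prime L -> (0 < prodl L)%N.
Proof.
by move=> /allP hL; rewrite /prodl big_seq prodn_cond_gt0 // => p /hL /prime_gt0.
Qed.

Lemma dvdn_prodl L r : r \in L -> (r %| prodl L)%N.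
Proof. by move=> rL; rewrite /prodl (big_rem r rL) dvdn_mulr. Qed.

Lemma prime_dvd_prodl q L : prime q -> all prime L -> (q %| prodl L)%N = (q \in L).
Proof.
move=> pq; rewrite /prodl; elim: L => [|p L IH] /=; first by rewrite big_nil dvdn1 -[RHS]/false; case: q pq => [|[]].
by case/andP=> pp /IH{}IH; rewrite big_cons Euclid_dvdM // IH inE dvdn_prime2.
Qed.

Lemma prodl_dvd L L' : uniq L -> uniq L' -> {subset L <= L'} -> (prodl L %| prodl L')%N.
Proof.
rewrite /prodl; elim: L L' => [|p L IH] L' /=; first by rewrite big_nil dvd1n.
case/andP=> pL uL uL' sL; have pL' : p \in L' by apply: sL; rewrite mem_head.
rewrite big_cons (big_rem p pL') /= dvdn_mul // IH ?rem_uniq // => x xL.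
rewrite mem_rem_uniq // inE sL ?inE ?xL ?orbT // andbT.
by apply: contraNneq pL => <-.
Qed.

(** The shift [s0] carries the denominators that occur in the edges but not yet in [L]; it
    becomes irrelevant when all these primes have joined [L]. *)
Definition covers (E : nat -> Prop) (L : seq nat) (s0 lo hi : rat) : Prop :=
  forall v, lo <= v <= hi -> (v - s0) * (prodl L)%:R \is a Num.int -> egyptian E v.

Lemma ler_sum_subseq (D C : seq nat) (f : nat -> rat) : (forall x, 0 <= f x) ->
  subseq D C -> \sum_(r <- D) f r <= \sum_(r <- C) f r.
Proof.
move=> f0; elim: C D => [|c C IH] [|d D] //=.
  by rewrite big_nil sumr_ge0.
case: eqP => [->|_] sD; first by rewrite !big_cons lerD2l IH.
by apply: le_trans (IH _ sD) _; rewrite [X in _ <= X]big_cons lerDr.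
Qed.

(** The residue of the target modulo [P] selects the edges at [P]; what remains is a target
    without [P] in its denominator, still above [lo]. *)
Lemma covers_add_prime E L s0 lo hi P C : all prime L -> prime P -> P \notin L ->
  uniq C -> {subset C <= L} -> complete P C -> (forall n, E n -> ~ star C P n) ->
  covers E L s0 lo hi ->
  covers (fun n => E n \/ star C P n) (P :: L) s0 (lo + \sum_(r <- C) (r * P)%:R^-1) hi.
Proof.
move=> pL pP PL uC sC cC fresh cov v /andP[h1 h2].
rewrite /prodl big_cons natrM -/(prodl L) => /intrP[x ex].
have P0 : P%:R != 0 :> rat by rewrite pnatr_eq0 -lt0n prime_gt0.
have m0 : (prodl L)%:R != 0 :> 'F_P by rewrite Fp_natr_eq0 ?prime_dvd_prodl.
have [D sD eD] := cC (x%:~R / (prodl L)%:R).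
have Dpos r : 0 <= (r * P)%:R^-1 :> rat by rewrite invr_ge0.
rewrite -[v](subrK (\sum_(r <- D) (r * P)%:R^-1)).
apply: egyptianD => //; last first.
  apply: egyptian_star; rewrite ?prime_gt0 ?(subseq_uniq sD) //; exact: mem_subseq.
have h3 := ler_sum_subseq Dpos sD.
have h4 : 0 <= \sum_(r <- D) (r * P)%:R^-1 :> rat by apply: sumr_ge0.
apply: cov; first by apply/andP; split; lra.
rewrite addrAC mulrBl [X in _ - X]mulrC.
rewrite (_ : (v - s0) * _ = x%:~R / P%:R); last by rewrite -ex; field.
apply: int_div_balanced => //; last by rewrite eD mulrC divfK.
move=> r rD; have rL := sC r (mem_subseq sD rD); rewrite dvdn_prodl //; split => //.
by have pr := allP pL r rL; rewrite dvdn_prime2 //; apply: contraNneq PL => ->.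
Qed.

(** As the edge is not longer than the interval, [v] or [v - 1/n] lies in the interval. *)
Lemma covers_add_edge E L s0 lo hi n : covers E L s0 lo hi -> ~ E n ->
  s0 * (prodl L)%:R \is a Num.int -> (n %| prodl L)%N -> (0 < n)%N -> n%:R^-1 <= hi - lo ->
  covers (fun k => E k \/ k = n) L s0 lo (hi + n%:R^-1).
Proof.
move=> cov En _ nL n0 hn v /andP[h1 h2] hv.
have [hle|hgt] := lerP v hi.
  by apply: egyptian_sub (cov v _ hv) => [k|]; [left | rewrite h1].
rewrite -[v](subrK n%:R^-1); apply: egyptianD.
- by move=> k Ek kn; apply: En; rewrite -kn.
- apply: cov; first by apply/andP; split; lra.
  rewrite addrAC mulrBl rpredB //; have [k ->] := dvdnP nL.
  by rewrite natrM mulrCA mulVf ?mulr1 ?rpred_nat // pnatr_eq0 -lt0n.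
- exists [:: n]; split; rewrite ?big_seq1 // => k; rewrite inE => /eqP ->.
  by [].
Qed.

(** * Almost invariant finite sets *)

(** As a function of [x] this boundary is even and subadditive, so that bounds for gadgets
    pass to their signed sums. *)
Definition lam (S : seq rat) (x : rat) : nat := count (fun s => s + x \notin S) S.

Lemma lam0 S : lam S 0 = 0%N.
Proof. by apply/eqP; rewrite -leqn0 leqNgt -has_count; apply/hasPn => s sS; rewrite addr0 sS. Qed.

Lemma lam_compl S x : (lam S x + count (fun s => (s + x)%R \in S) S)%N = size S.
Proof. by rewrite addnC -(count_predC (fun s => s + x \in S) S). Qed.

Lemma leq_count_inj (S : seq rat) (a b : pred rat) (f : rat -> rat) : uniq S -> injective f ->
  {in S, forall s, a s -> (f s \in S) && b (f s)} -> (count a S <= count b S)%N.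
Proof.
move=> uS fI h; rewrite -!size_filter -(size_map f); apply: uniq_leq_size.
  by rewrite map_inj_uniq // filter_uniq.
move=> _ /mapP[s + ->]; rewrite !mem_filter => /andP[sa sS].
by rewrite andbC h.
Qed.

Lemma lamN S x : uniq S -> (lam S (- x) <= lam S x)%N.
Proof.
move=> uS; rewrite -(leq_add2r (count (fun s => (s - x)%R \in S) S)) lam_compl.
rewrite -(lam_compl S x) leq_add2l.
apply: (@leq_count_inj _ _ _ (fun s => s + x)) => //; first exact: addIr.
by move=> s sS ->; rewrite addrK sS.
Qed.

Lemma lamD S x y : uniq S -> (lam S (x + y) <= lam S x + lam S y)%N.
Proof.
move=> uS; rewrite /lam.
pose a s := (s + x \in S) && (s + (x + y) \notin S).
apply: (@leq_trans (count (predU (fun s => (s + x)%R \notin S) a) S)).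
  by apply: sub_count => s /= h; rewrite /a h andbT orNb.
have := count_predUI (fun s => s + x \notin S) a S.
suff : (count a S <= count (fun s => (s + y)%R \notin S) S)%N by lia.
apply: (@leq_count_inj _ _ _ (fun s => s + x)) => //; first exact: addIr.
by move=> s sS; rewrite /a addrA.
Qed.

(** A slot is a prime reserved to a single gadget: gadgets of distinct slots share no edge.
    [G q g] means that [g] is the value of a gadget available for the slot [q]. *)
Fixpoint reach (G : nat -> rat -> Prop) (qs : seq nat) (s : rat) : Prop :=
  if qs is q :: qs' then reach G qs' s \/ exists2 g, G q g & reach G qs' (s - g)
  else s = 0.

(** One slot after the other is used to enlarge the set by the factor [1 + 1 / N], until a
    slot is met none of whose gadgets does so. *)
Lemma growth_or_stall (G : nat -> rat -> Prop) (N : nat) (qs : seq nat) :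
  exists S, [/\ uniq S, (0 < size S)%N, {in S, forall s, reach G qs s} &
    (exists2 q, q \in qs & forall g, G q g -> (N * lam S g <= size S)%N) \/
    (N.+1 ^ size qs <= N ^ size qs * size S)%N].
Proof.
elim: qs => [|q qs [S [uS S0 hS stall]]].
  by exists [:: 0]; split=> //= [s|]; [rewrite inE => /eqP | right].
case: stall => [[q' q'qs hq']|hgrow].
  exists S; split=> //; first by move=> s /hS; left.
  by left; exists q' => //; rewrite inE q'qs orbT.
have [hst|] := classic (forall g, G q g -> (N * lam S g <= size S)%N).
  exists S; split=> //; first by move=> s /hS; left.
  by left; exists q => //; rewrite mem_head.
move=> nst; have [g hg0] := not_all_ex_not _ _ nst.
have [Gg /negP] := imply_to_and _ _ hg0; rewrite -ltnNge => {nst hg0}hg.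
(* Adding the gadget to all sums creates [lam S g] new ones. *)
exists (S ++ [seq s + g | s <- S & s + g \notin S]); split.
- rewrite cat_uniq uS (map_inj_uniq (addIr g)) filter_uniq // andbT.
  by apply/hasPn => _ /mapP[s + ->]; rewrite mem_filter => /andP[].
- by rewrite size_cat; lia.
- move=> s; rewrite mem_cat => /orP[/hS|/mapP[s' + ->]]; first by left.
  by rewrite mem_filter => /andP[_ /hS h]; right; exists g => //; rewrite addrK.
right; rewrite size_cat size_map size_filter -/(lam S g) /= !expnS.
have h2 : (N.+1 * size S <= N * (size S + lam S g))%N by lia.
apply: leq_trans (leq_mul (leqnn N.+1) hgrow) _.
have := leq_mul (leqnn (N ^ size qs)) h2.
by move: (size S) (lam S g) (N ^ size qs)%N; clear; nia.
Qed.

Lemma leq_double_expnS N : (0 < N)%N -> (2 * N ^ N <= N.+1 ^ N)%N.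
Proof.
case: N => // n _; rewrite -[n.+2]addn1 expnDn.
rewrite big_ord_recl big_ord_recl /= subn0 !exp1n bin0 bin1 /bump /= !muln1 mul1n subSS subn0.
by rewrite -expnS mul2n -addnn addnA leq_addr.
Qed.

Lemma leq_expnS N l : (0 < N)%N -> (2 ^ l * N ^ (N * l) <= N.+1 ^ (N * l))%N.
Proof.
by move=> N0; rewrite !expnM -expnMn; case: l => // l; rewrite leq_exp2r ?leq_double_expnS.
Qed.

(** Growth through all the slots would give more than [2^l] sums. *)
Lemma stalled_slot (G : nat -> rat -> Prop) (N l M : nat) (qs : seq nat) : (0 < N)%N ->
  size qs = (N * l)%N -> (M < 2 ^ l)%N ->
  (forall S : seq rat, uniq S -> {in S, forall s, reach G qs s} -> (size S <= M)%N) ->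
  exists S q, [/\ uniq S, (0 < size S)%N, {in S, forall s, reach G qs s}, q \in qs &
    forall g, G q g -> (N * lam S g <= size S)%N].
Proof.
move=> N0 sq Ml bound; have [S [uS S0 hS [[q qqs hq]|]]] := growth_or_stall G N qs.
  by exists S, q.
rewrite sq leqNgt => /negP[]; apply: leq_trans (leq_expnS l N0).
rewrite mulnC ltn_pmul2r ?expn_gt0 ?N0 //.
exact: leq_ltn_trans (bound S uS hS) Ml.
Qed.

(** On average over [s] in [S], at most one eighth of the translates of [s] leave [S]. *)
Lemma dense_window (S : seq rat) (d : rat) K : (0 < size S)%N ->
  (forall k, (k <= K)%N -> (8 * lam S (k%:R * d) <= size S)%N) ->
  exists2 s, s \in S & (8 * count (fun k => (s + k%:R * d)%R \notin S) (iota 0 K.+1) <= K.+1)%N.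
Proof.
move=> S0 h.
have [|s sS hs] := @exists_le_average _ S (fun s => 8 * count (fun k => (s + k%:R * d)%R \notin S)
    (iota 0 K.+1))%N _ (size S * K.+1) S0 (leqnn _); last first.
  by exists s => //; move: hs; rewrite leq_pmul2l.
have -> : (\sum_(s <- S) 8 * count (fun k => (s + k%:R * d)%R \notin S) (iota 0 K.+1) =
    \sum_(k <- iota 0 K.+1) 8 * lam S (k%:R * d)%R)%N.
  rewrite -!big_distrr; congr (_ * _)%N.
  have cE (T : Type) (a : pred T) r : count a r = (\sum_(x <- r) (a x : nat))%N.
    by rewrite -sum1_count big_mkcond; apply: eq_bigr => x _; case: (a x).
  rewrite (eq_bigr _ (fun s _ => cE _ _ _)) exchange_big /=.
  by apply: eq_bigr => k _; rewrite /lam cE.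
have -> : (size S * K.+1 = \sum_(k <- iota 0 K.+1) size S)%N.
  by rewrite big_const_seq count_predT size_iota iter_addn_0.
by rewrite !big_seq; apply: leq_sum => k; rewrite mem_iota => hk; apply: h; lia.
Qed.

(** * Gadgets *)

(** In [y / m = sum of c p / p + a - size L] the numerators [c p] stay below [p] whatever
    [y] is, and [a] is close to [y / m]: this bounds the moves in [stalled_translates]. *)
Lemma partial_fractions (L : seq nat) (y : nat) : all prime L -> uniq L ->
  exists (c : nat -> nat) (a : nat), {in L, forall p, c p < p}%N /\
    (y + size L * prodl L = \sum_(p <- L) c p * (prodl L %/ p) + a * prodl L)%N.
Proof.
elim: L y => [|p L IH] y /=.
  by exists id, y; split=> [x //|]; rewrite /prodl !big_nil; lia.
case/andP=> pp pL /andP[pnL uL].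
have m'0 : (prodl L)%:R != 0 :> 'F_p by rewrite Fp_natr_eq0 // prime_dvd_prodl.
have e : prodl (p :: L) = (p * prodl L)%N by rewrite /prodl big_cons.
set m' := prodl L in IH e m'0 *.
pose c0 : nat := val (y%:R / m'%:R : 'F_p).
have c0p : (c0 < p)%N by have := ltn_ord (y%:R / m'%:R : 'F_p); rewrite [X in (_ < X)%N -> _]Fp_cast.
have c0m : (c0 * m' <= p * m')%N by rewrite leq_mul2r ltnW ?orbT.
have : (p %| y + p * m' - c0 * m')%N.
  rewrite -Fp_natr_eq0 // natrB; last by apply: leq_trans c0m (leq_addl _ _).
  rewrite natrD !natrM pchar_Fp_0 // mul0r addr0 /c0 natr_Zp divfK ?subrr //.
case/dvdnP => y' ey'.
have {ey'}ey : (y + p * m' = c0 * m' + p * y')%N by rewrite [(p * y')%N]mulnC -ey'; lia.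
have [c [a [hc hy]]] := IH y' pL uL.
exists (fun x => if x == p then c0 else c x), a; split.
  by move=> x; rewrite inE; case: eqP => [->|_] //= /hc.
rewrite big_cons eqxx e mulKn ?prime_gt0 //.
rewrite (_ : (\sum_(j <- L) _)%N = (p * \sum_(r <- L) c r * (m' %/ r))%N).
  by move: hy ey; move: (\sum_(_ <- _) _)%N (size L) => s l; nia.
rewrite big_distrr /= !big_seq; apply: eq_bigr => r rL.
case: eqP => [rp|_]; first by rewrite -rp rL in pnL.
have /dvdnP[d ->] : (r %| m')%N := dvdn_prodl rL.
have r0 : (0 < r)%N by rewrite prime_gt0 ?(allP pL).
by rewrite mulnA mulnK // mulnK //; lia.
Qed.

Lemma partial_fractions_field (F : fieldType) L (c : nat -> nat) a y :
  {in L, forall r, r%:R != 0 :> F} -> (prodl L)%:R != 0 :> F ->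
  (y + size L * prodl L = \sum_(p <- L) c p * (prodl L %/ p) + a * prodl L)%N ->
  y%:R / (prodl L)%:R + (size L)%:R = \sum_(p <- L) (c p)%:R / p%:R + a%:R :> F.
Proof.
move=> hL m0 /(congr1 (fun n : nat => n%:R : F)); rewrite !natrD !natrM natr_sum => e.
rewrite -[LHS](mulfK m0) mulrDl divfK // e mulrDl mulfK //; congr (_ + _).
rewrite mulr_suml !big_seq; apply: eq_bigr => r rL.
have r0 := hL r rL; have /dvdnP[d ed] := dvdn_prodl rL.
have rp : (0 < r)%N by rewrite lt0n; apply: contraNneq r0 => ->.
rewrite natrM ed mulnK // natrM invfM mulrA.
have d0 : d%:R != 0 :> F by move: m0; rewrite ed natrM mulf_eq0 negb_or => /andP[].
by field; rewrite d0 r0.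
Qed.

(** The edges between [q] and [C] form a gadget when their sum has no [q] in its
    denominator; the bound on the sum of reciprocals keeps its value below [1 / q]. *)
Definition gadget (A : seq nat) (q : nat) (g : rat) : Prop :=
  exists C, [/\ uniq C, {subset C <= A}, \sum_(r <- C) r%:R^-1 = 0 :> 'F_q,
    \sum_(r <- C) r%:R^-1 <= 1 :> rat & g = \sum_(r <- C) (r * q)%:R^-1].

Definition gedge (A qs : seq nat) (n : nat) : Prop :=
  exists2 q, q \in qs & exists2 p, p \in A & n = (p * q)%N.

Lemma reach_gadgets (A qs : seq nat) q0 s : uniq A -> all prime A -> uniq qs -> all prime qs ->
  {in qs, forall q, q \notin A /\ (q0 <= q)%N} -> (0 < q0)%N -> reach (gadget A) qs s ->
  [/\ 0 <= s <= (size qs)%:R / q0%:R, s * (prodl A)%:R \is a Num.int & egyptian (gedge A qs) s].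
Proof.
move=> uA pA; elim: qs s => [|q qs IH] s /=.
  move=> _ _ _ _ ->; rewrite mul0r lexx mul0r rpred0; split=> //; exact: egyptian0.
case/andP=> qqs uqs /andP[pq pqs] hqs q00.
have tl x : x \in qs -> x \in q :: qs by rewrite inE => ->; rewrite orbT.
have IH' := IH _ uqs pqs (fun x h => hqs x (tl x h)) q00.
have [qA q0q] := hqs q (mem_head _ _).
have q0r : 0 < q0%:R :> rat by rewrite ltr0n.
have qr : 0 < q%:R :> rat by rewrite ltr0n prime_gt0.
have sE n : gedge A qs n -> gedge A (q :: qs) n.
  by case=> x xqs h; exists x => //; rewrite inE xqs orbT.
have iq : 0 < q0%:R^-1 :> rat by rewrite invr_gt0.
case=> [/IH'[/andP[h1 h2] h3 h4]|[gv [C [uC sC C0 C1 ->]] /IH'[/andP[h1 h2] h3 h4]]].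
  split=> //; last exact: egyptian_sub h4.
  by rewrite h1 /= -natr1 mulrDl; lra.
set g := \sum_(r <- C) _ in h1 h2 h3 h4.
have g0 : 0 <= g by apply: sumr_ge0 => r _; rewrite invr_ge0.
have g1 : g <= q0%:R^-1.
  have -> : g = (\sum_(r <- C) r%:R^-1) / q%:R.
    by rewrite mulr_suml; apply: eq_bigr => r _; rewrite natrM invfM.
  apply: (@le_trans _ _ (1 / q%:R)); first by rewrite ler_pM2r ?invr_gt0.
  by rewrite div1r lef_pV2 ?posrE // ler_nat.
rewrite -[s](subrK g); split.
- by rewrite -natr1 mulrDl; apply/andP; split; lra.
- rewrite mulrDl rpredD // mulrC.
  have : (0 : int)%:~R / q%:R - (prodl A)%:R * g \is a @Num.int rat.
    apply: int_div_balanced => //; last by rewrite C0 mulr0.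
    move=> r /sC rA; rewrite dvdn_prodl //; split=> //.
    by have pr := allP pA r rA; rewrite dvdn_prime2 //; apply: contraNneq qA => ->.
  by rewrite mul0r sub0r rpredN.
apply: egyptian_sub (egyptianD _ h4 (egyptian_star (prime_gt0 pq) uC sC)) => [n|n].
  by case=> [/sE//|[r rA ->]]; exists q; [rewrite mem_head | exists r].
case=> q' q'qs [p pA' ->] [r rA e].
have pq' := allP pqs q' q'qs; have [q'A _] := hqs q' (tl q' q'qs).
have [] := semiprime_inj (allP pA p pA') pq' (allP pA r rA) pq e.
  by case=> _ eq'; rewrite -eq' q'qs in qqs.
by case=> _ eq'; rewrite eq' rA in q'A.
Qed.

(** Let [psi t] be the value of a list in [P2] with sum of reciprocals [t]. A list in [P3]
    completes both [p] with the list of [t], and the list of [t + 1 / p], to gadgets at [q].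
    Their difference is [1 / (p q) + psi t - psi (t + 1 / p)], so it moves few elements. *)
Lemma stalled_moves (L P2 P3 : seq nat) q N S : all prime (L ++ P2 ++ P3) ->
  uniq (L ++ P2 ++ P3) -> \sum_(r <- P2 ++ P3) r%:R^-1 <= 1 / 2 :> rat ->
  complete q P2 -> complete q P3 -> uniq S ->
  (forall g, gadget (L ++ P2 ++ P3) q g -> (N * lam S g <= size S)%N) ->
  exists psi : 'F_q -> rat, forall p, p \in L -> forall c t,
    (N * lam S (c%:R * (p * q)%:R^-1 + psi t - psi (t + c%:R * p%:R^-1))%R <= 2 * c * size S)%N.
Proof.
move=> pA uA small c2 c3 uS hst.
have /fin_all_exists2[D sD eD] := c2.
pose psi (t : 'F_q) : rat := \sum_(r <- D t) (r * q)%:R^-1.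
exists psi => p pL.
have step (t : 'F_q) : (N * lam S ((p * q)%:R^-1 + psi t - psi (t + p%:R^-1))%R <= 2 * size S)%N.
  have [F sF eF] := c3 (- (t + p%:R^-1)).
  have ss (t' : 'F_q) : subseq (D t' ++ F) (P2 ++ P3) by rewrite cat_subseq.
  have ge0 r : 0 <= r%:R^-1 :> rat by rewrite invr_ge0.
  have hs t' : \sum_(r <- D t' ++ F) r%:R^-1 <= 1 / 2 :> rat.
    exact: le_trans (ler_sum_subseq ge0 (ss t')) small.
  have p2 : p%:R^-1 <= 1 / 2 :> rat.
    have pp : prime p by apply: (allP pA); rewrite mem_cat pL.
    by rewrite div1r lef_pV2 ?posrE ?ltr0n ?prime_gt0 // ler_nat prime_gt1.
  have h1 : gadget (L ++ P2 ++ P3) q (\sum_(r <- p :: D t ++ F) (r * q)%:R^-1).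
    exists (p :: D t ++ F); split=> //.
    - move: uA; rewrite (cat_uniq L) => /and3P[_ /hasPn h u] /=; rewrite (subseq_uniq (ss t)) // andbT.
      by apply: contraL pL => /(mem_subseq (ss t)) /h.
    - move=> x; rewrite inE => /orP[/eqP->|/(mem_subseq (ss t)) h]; rewrite mem_cat ?pL //.
      by rewrite h orbT.
    - by rewrite big_cons big_cat /= eD eF addrA [p%:R^-1 + t]addrC subrr.
    - by rewrite big_cons; have := hs t; lra.
  have h2 : gadget (L ++ P2 ++ P3) q (\sum_(r <- D (t + p%:R^-1) ++ F) (r * q)%:R^-1).
    exists (D (t + p%:R^-1) ++ F); split=> //.
    - by move: uA; rewrite (cat_uniq L) => /and3P[_ _ u]; rewrite (subseq_uniq (ss _)).
    - by move=> x /(mem_subseq (ss _)) h; rewrite mem_cat h orbT.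
    - by rewrite big_cat /= eD eF subrr.
    - by have := hs (t + p%:R^-1); lra.
  have -> : (p * q)%:R^-1 + psi t - psi (t + p%:R^-1) =
      \sum_(r <- p :: D t ++ F) (r * q)%:R^-1 - \sum_(r <- D (t + p%:R^-1) ++ F) (r * q)%:R^-1.
    by rewrite big_cons !big_cat /= /psi; ring.
  have := lamD (\sum_(r <- p :: D t ++ F) (r * q)%:R^-1)
     (- \sum_(r <- D (t + p%:R^-1) ++ F) (r * q)%:R^-1) uS.
  have := lamN (\sum_(r <- D (t + p%:R^-1) ++ F) (r * q)%:R^-1) uS.
  move: (hst _ h1) (hst _ h2); clear; move: (lam _ _) (lam _ _) (lam _ _) (lam _ _) (size S); nia.
elim=> [|c IH] t; first by rewrite !mul0r !addr0 add0r subrr lam0 !muln0.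
rewrite (_ : _ - _ = (c%:R * (p * q)%:R^-1 + psi t - psi (t + c%:R * p%:R^-1)) +
  ((p * q)%:R^-1 + psi (t + c%:R * p%:R^-1) - psi (t + c%:R * p%:R^-1 + p%:R^-1))).
  apply: leq_trans (leq_mul (leqnn N) (lamD _ _ uS)) _.
  by have := IH t; have := step (t + c%:R * p%:R^-1); clear; move: (lam _ _) (lam _ _) (size S); nia.
have -> : t + c.+1%:R * p%:R^-1 = t + c%:R * p%:R^-1 + p%:R^-1 by rewrite -natr1 mulrDl mul1r addrA.
by rewrite -natr1; ring.
Qed.

(** * The first interval *)

(** Write [q k / m] in partial fractions over [L] and follow the moves of [stalled_moves]
    through them: the corrections [psi] telescope, and those at the two ends agree because
    [q k / m] vanishes modulo [q]. The prime [2] serves to add and subtract integers. *)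
Lemma stalled_translates (L P2 P3 : seq nat) q N S k B : all prime (L ++ P2 ++ P3) ->
  uniq (L ++ P2 ++ P3) -> \sum_(r <- P2 ++ P3) r%:R^-1 <= 1 / 2 :> rat ->
  complete q P2 -> complete q P3 -> uniq S ->
  (forall g, gadget (L ++ P2 ++ P3) q g -> (N * lam S g <= size S)%N) ->
  prime q -> q \notin L -> 2 \in L -> (q * k <= B * prodl L)%N ->
  (N * lam S (k%:R / (prodl L)%:R)%R <=
     2 * (\sum_(p <- L) p + 2 * B + 4 * size L) * size S)%N.
Proof.
move=> pA uA small c2 c3 uS hst pq qL L2 qkB.
have [psi hpsi] := stalled_moves pA uA small c2 c3 uS hst.
have pL : all prime L by move: pA; rewrite all_cat => /andP[].
have uL : uniq L by move: uA; rewrite cat_uniq => /and3P[].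
have [c [a [hc hy]]] := partial_fractions (q * k) pL uL.
have m0 := prodl_gt0 pL.
have aB : (a <= B + size L)%N.
  rewrite -(leq_pmul2r m0) mulnDl; apply: (@leq_trans (q * k + size L * prodl L)).
    by rewrite hy leq_addl.
  by rewrite leq_add2r.
have rF r : r \in L -> r%:R != 0 :> 'F_q.
  move=> rL; rewrite Fp_natr_eq0 // dvdn_prime2 ?(allP pL r rL) //.
  by apply: contraNneq qL => ->.
have hF := partial_fractions_field rF _ hy; have {hF}hF := hF _.
have rQ r : r \in L -> r%:R != 0 :> rat by move=> /(allP pL) pr; rewrite pnatr_eq0 -lt0n prime_gt0.
have hQ := partial_fractions_field rQ _ hy.
have mQ : (prodl L)%:R != 0 :> rat by rewrite pnatr_eq0 -lt0n.
have mF : (prodl L)%:R != 0 :> 'F_q by rewrite Fp_natr_eq0 // prime_dvd_prodl.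
have qQ : q%:R != 0 :> rat by rewrite pnatr_eq0 -lt0n prime_gt0.
have {}hF := hF mF; have {}hQ := hQ mQ.
have walk (l : seq nat) t : {subset l <= L} -> (N * lam S (\sum_(p <- l) (c p)%:R * (p * q)%:R^-1 + psi t
    - psi (t + \sum_(p <- l) (c p)%:R / p%:R))%R <= 2 * (\sum_(p <- l) c p) * size S)%N.
  elim: l t => [|p l IH] t sl; first by rewrite !big_nil add0r addr0 subrr lam0 !muln0.
  have pl : p \in L by apply: sl; rewrite mem_head.
  have {}sl : {subset l <= L} by move=> x xl; apply: sl; rewrite inE xl orbT.
  have h1 := hpsi p pl (c p) t.
  have {IH}h2 := IH (t + (c p)%:R / p%:R) sl.
  rewrite !big_cons addrA; set u := \sum_(_ <- _) _ in h2 *; set w := t + _ in h1 h2 *.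
  rewrite (_ : _ - _ = ((c p)%:R * (p * q)%:R^-1 + psi t - psi w) +
    (u + psi w - psi (w + \sum_(p <- l) (c p)%:R / p%:R))); last by ring.
  apply: leq_trans (leq_mul (leqnn N) (lamD _ _ uS)) _.
  by move: h1 h2; clear; move: (lam _ _) (lam _ _) (size S) (\sum_(_ <- _) _)%N; nia.
have h1 := walk L 0 (fun _ h => h).
set T := \sum_(p <- L) (c p)%:R / p%:R in h1 hF.
have h2 := hpsi 2%N L2 (2 * a)%N (0 + T).
have h3 := hpsi 2%N L2 (2 * size L)%N 0.
have q2 : (2%:R : 'F_q) != 0 by apply: rF.
(* An integer [n] is [2 n] times [1 / 2], that is [2 n] moves at the prime [2]. *)
have e2 (n : nat) : (2 * n)%:R * 2%:R^-1 = n%:R :> 'F_q by rewrite natrM mulrAC mulfV // mul1r.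
have e2q (n : nat) : (2 * n)%:R * (2 * q)%:R^-1 = n%:R / q%:R :> rat by rewrite !natrM; field.
rewrite e2 e2q in h2; rewrite e2 e2q in h3.
(* The residue reached by the moves up is the one from which the moves down return. *)
have eT : 0 + T + a%:R = 0 + (size L)%:R.
  by rewrite !add0r -hF natrM pchar_Fp_0 // !mul0r add0r.
rewrite eT in h2.
set x1 := (_ - _) in h1; set x2 := (_ - _) in h2; set x3 := (_ - _) in h3.
have -> : k%:R / (prodl L)%:R = x1 + (x2 - x3).
  transitivity (((q * k)%:R / (prodl L)%:R) / q%:R : rat).
    by rewrite natrM; field; rewrite qQ mQ.
  have -> : (q * k)%:R / (prodl L)%:R = \sum_(p <- L) (c p)%:R / p%:R + a%:R - (size L)%:R :> rat.
    by rewrite -hQ addrK.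
  rewrite /x1 /x2 /x3 mulrBl mulrDl mulr_suml.
  rewrite (eq_bigr (fun p => (c p)%:R * (p * q)%:R^-1)); last first.
    by move=> p _; rewrite natrM invfM mulrA.
  by ring.
have hcs : (\sum_(p <- L) c p <= \sum_(p <- L) p)%N.
  by rewrite !big_seq; apply: leq_sum => p /hc /ltnW.
have d1 := lamD x1 (x2 - x3) uS; have d2 := lamD x2 (- x3) uS; have d3 := lamN x3 uS.
move: h1 h2 h3 d1 d2 d3 hcs aB; clear.
move: (lam _ _) (lam _ _) (lam _ _) (lam _ _) (lam _ _) (lam _ _) (size S) (\sum_(_ <- _) _)%N.
move: (\sum_(_ <- _) _)%N (size L) => s l m3' y z w3 w2 w1 m cs h1 h2 h3 d1 d2 d3 hcs aB.
have hz : (z <= w1 + w2 + w3)%N by lia.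
apply: leq_trans (leq_mul (leqnn N) hz) _; rewrite !mulnDr.
apply: (@leq_trans (2 * (cs + 2 * a + 2 * l) * m)); first by lia.
by rewrite leq_mul2r; apply/orP; right; lia.
Qed.

(** Each set misses at most one eighth of the window, while the pairs [k], [t - k] in the
    window are more than half as many as its elements. *)
Lemma window_sum (T T' : pred nat) K t : (K <= t <= K + K./2)%N ->
  (8 * count (predC T) (iota 0 K.+1) <= K.+1)%N ->
  (8 * count (predC T') (iota 0 K.+1) <= K.+1)%N ->
  exists k, [/\ (k <= K)%N, (k <= t)%N, (t - k <= K)%N, T k & T' (t - k)%N].
Proof.
move=> /andP[Kt tK] hT hT'.
pose W := iota (t - K) (2 * K - t).+1.
pose bad := predU (predC T) (fun k => ~~ T' (t - k)%N).
have hb : (count bad W < size W)%N.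
  have := count_predUI (predC T) (fun k => ~~ T' (t - k)%N) W; rewrite -/bad => h.
  have e1 : (count (predC T) W <= count (predC T) (iota 0 K.+1))%N.
    rewrite -!size_filter; apply: uniq_leq_size; first by rewrite filter_uniq ?iota_uniq.
    move=> x; rewrite !mem_filter !mem_iota => /andP[hx h2].
    by apply/andP; split; [exact: hx | lia].
  have e2 : (count (fun k => ~~ T' (t - k)%N) W <= count (predC T') (iota 0 K.+1))%N.
    rewrite -!size_filter -(size_map (fun k => t - k)%N); apply: uniq_leq_size.
      rewrite map_inj_in_uniq ?filter_uniq ?iota_uniq // => x y.
      by rewrite !mem_filter !mem_iota; lia.
    move=> _ /mapP[x + ->]; rewrite !mem_filter !mem_iota => /andP[hx h2].
    by apply/andP; split; [exact: hx | lia].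
  rewrite size_iota; lia.
have : has (predC bad) W.
  rewrite has_count; have := count_predC bad W; lia.
case/hasP=> k; rewrite mem_iota /= => hk; rewrite negb_or !negbK => /andP[h1 h2].
exists k; split=> //; lia.
Qed.

Lemma leq_size_bounded (S : seq rat) m : uniq S -> (0 < m)%N ->
  {in S, forall s, 0 <= s <= 1 /\ s * m%:R \is a Num.int} -> (size S <= m.+1)%N.
Proof.
move=> uS m0 h; have mr : 0 < m%:R :> rat by rewrite ltr0n.
rewrite -[X in (_ <= X)%N](size_iota 0) -(size_map (fun i : nat => i%:R / m%:R : rat)).
apply: uniq_leq_size => // s /h[/andP[s0 s1] hs].
have : s * m%:R \is a Num.nat by rewrite natrEint hs mulr_ge0 ?ler0n.
case/natrP=> i ei; apply/mapP; exists i; last by rewrite -ei mulfK ?gt_eqF.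
rewrite mem_iota leq0n add0n ltnS /= -(ler_nat rat) -ei -[X in _ <= X]mul1r.
by rewrite ler_pM2r.
Qed.

(** Two disjoint families of [N l] slots give two almost invariant sets. The number of
    slots bounds the cost, as every gadget is at most [1 / q0]. *)
Lemma core_interval (L P2 P3 Q : seq nat) (q0 K B N l : nat) : all prime (L ++ P2 ++ P3) ->
  uniq (L ++ P2 ++ P3) -> \sum_(r <- P2 ++ P3) r%:R^-1 <= 1 / 2 :> rat -> 2 \in L ->
  uniq Q -> {in Q, forall q, [/\ prime q, q \notin L ++ P2 ++ P3, (q0 <= q)%N,
     (q * K <= B * prodl L)%N & complete q P2 /\ complete q P3]} ->
  (16 * (\sum_(p <- L) p + 2 * B + 4 * size L) <= N)%N ->
  (prodl (L ++ P2 ++ P3) + 2 <= 2 ^ l)%N -> (2 * (N * l) <= size Q)%N -> (N * l <= q0)%N ->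
  exists s0, [/\ s0 * (prodl (L ++ P2 ++ P3))%:R \is a Num.int,
    s0 + K%:R / (prodl L)%:R <= (2 * (N * l))%:R / q0%:R &
    covers (gedge (L ++ P2 ++ P3) Q) L s0 (s0 + K%:R / (prodl L)%:R)
      (s0 + (K + K./2)%:R / (prodl L)%:R)].
Proof.
set A := L ++ P2 ++ P3 => pA uA small L2 uQ hQ hN hl sQ nq0.
set m := prodl L.
have pL : all prime L by move: pA; rewrite all_cat => /andP[].
have m0 : (0 < m)%N by apply: prodl_gt0.
have hs : (1 < prodl A)%N.
  have h2 : (2 %| prodl A)%N by apply: dvdn_prodl; rewrite mem_cat L2.
  by apply: dvdn_leq h2; apply: prodl_gt0.
have N0 : (0 < N)%N.
  apply: leq_trans hN; case: (L) L2 => // p l' _ /=; lia.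
have l0 : (0 < l)%N by case: l hl {sQ nq0}; first lia.
have q00 : (0 < q0)%N by apply: leq_trans nq0; rewrite muln_gt0 N0.
have half qs : subseq qs Q -> size qs = (N * l)%N ->
  exists (S : seq rat) s, [/\ s \in S, {in S, forall x, [/\ 0 <= x <= (N * l)%:R / q0%:R,
      x * (prodl A)%:R \is a Num.int & egyptian (gedge A qs) x]} &
    (8 * count (predC (fun k : nat => (s + k%:R * m%:R^-1)%R \in S)) (iota 0 K.+1) <= K.+1)%N].
  move=> sqs eqs.
  have hqs q : q \in qs -> q \in Q by apply: mem_subseq.
  have pqs : all prime qs by apply/allP => q /hqs /hQ[].
  have hr s : reach (gadget A) qs s -> [/\ 0 <= s <= (N * l)%:R / q0%:R,
      s * (prodl A)%:R \is a Num.int & egyptian (gedge A qs) s].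
    rewrite -eqs; apply: reach_gadgets; rewrite ?(subseq_uniq sqs) //.
    by move=> q /hqs /hQ[].
  have [|S uS hS|S [q [uS S0 hS qqs hst]]] := @stalled_slot (gadget A) N l (prodl A).+1 qs N0 eqs.
  - lia.
  - apply: leq_size_bounded => //; first by apply: ltnW.
    move=> s /hS/hr[/andP[h1 h2] h3 _]; split=> //; rewrite h1 /=; apply: le_trans h2 _.
    by rewrite ler_pdivrMr ?ltr0n // mul1r ler_nat.
  have [pq qA q0q qK [c2 c3]] := hQ q (hqs q qqs).
  have [|s sS hs'] := @dense_window S m%:R^-1 K S0.
    move=> k kK; have qL : q \notin L by apply: contra qA; rewrite mem_cat => ->.
    have qk : (q * k <= B * prodl L)%N by apply: leq_trans qK; rewrite leq_mul2l kK orbT.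
    have := stalled_translates pA uA small c2 c3 uS hst pq qL L2 qk.
    rewrite -/m; move: hN N0; clear.
    move: (lam _ _) (size S) (_ + _ + _)%N => x y z hN N0 h.
    rewrite -(leq_pmul2l N0); apply: leq_trans (_ : 8 * (2 * z * y) <= _)%N; first by nia.
    by rewrite (_ : 8 * (2 * z * y) = 16 * z * y)%N ?leq_mul2r ?hN ?orbT //; lia.
  by exists S, s; split=> // x /hS/hr.
have n2 : size (take (N * l) Q) = (N * l)%N by rewrite size_takel //; lia.
have n3 : size (take (N * l) (drop (N * l) Q)) = (N * l)%N.
  by rewrite size_takel // size_drop; lia.
have sub2 : subseq (take (N * l) Q) Q by apply: take_subseq.
have sub3 : subseq (take (N * l) (drop (N * l) Q)) Q.
  by apply: subseq_trans (take_subseq _ _) (drop_subseq _ _).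
have [S [s [sS hS wS]]] := half _ sub2 n2.
have [S' [s' [sS' hS' wS']]] := half _ sub3 n3.
have sums t : (K <= t <= K + K./2)%N ->
    exists x x', [/\ x \in S, x' \in S' & s + s' + t%:R / m%:R = x + x'].
  move=> ht; have [k [kK kt tkK Sk S'k]] := window_sum ht wS wS'.
  exists (s + k%:R * m%:R^-1), (s' + (t - k)%N%:R * m%:R^-1); split=> //.
  by rewrite natrB //; ring.
exists (s + s'); split.
- have [_ h1 _] := hS s sS; have [_ h2 _] := hS' s' sS'.
  by rewrite mulrDl rpredD.
- have [|x [x' [xS xS' ->]]] := sums K; first by rewrite leqnn leq_addr.
  have [/andP[_ h1] _ _] := hS x xS; have [/andP[_ h2] _ _] := hS' x' xS'.
  by rewrite natrM -mulrA; lra.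
move=> v /andP[h1 h2] hv.
have mr : 0 < m%:R :> rat by rewrite ltr0n.
have : (v - (s + s')) * m%:R \is a Num.nat.
  rewrite natrEint hv /=; apply: mulr_ge0; last exact: ltW.
  rewrite subr_ge0; apply: le_trans h1.
  by rewrite lerDl divr_ge0.
case/natrP=> t et.
have ev : v = s + s' + t%:R / m%:R by rewrite -et mulfK ?gt_eqF // addrC subrK.
have [|x [x' [xS xS' ex]]] := sums t.
  move: h1 h2; rewrite ev !lerD2l !ler_pM2r ?invr_gt0 // !ler_nat => -> ->; exact: isT.
rewrite ev ex; have [_ _ e1] := hS x xS; have [_ _ e2] := hS' x' xS'.
apply: egyptian_sub (egyptianD _ e1 e2) => [n|n].
  case=> [[q qs h]|[q qs h]]; exists q => //.
    exact: (mem_subseq sub2).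
  exact: (mem_subseq sub3).
case=> q qqs [p pA' ->] [q' qqs' [p' pA'' e]].
have qQ := mem_subseq sub2 qqs; have qQ' := mem_subseq sub3 qqs'.
have [pq qA _ _ _] := hQ q qQ; have [pq' qA' _ _ _] := hQ q' qQ'.
have [] := semiprime_inj (allP pA p pA') pq (allP pA p' pA'') pq' e.
  case=> _ eq'; move: uQ; rewrite -(cat_take_drop (N * l) Q) cat_uniq => /and3P[_ /hasPn h _].
  by have := h q'; rewrite (mem_take qqs') => /(_ isT); rewrite /= -eq' qqs.
by case=> eq'; rewrite -eq' pA' in qA'.
Qed.

(** * Complete lists at a given scale *)

Lemma size_primes_scale f t : (0 < t)%N -> (8 * f.+1 * t <= 2 ^ t)%N ->
  (3 * (2 ^ t) ^ f <= size (primes_in ((2 ^ t) ^ f) ((2 ^ t) ^ f.+1)))%N.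
Proof.
move=> t0 ht; set U := (2 ^ t)%N in ht *.
have s0 : (0 < t * f.+1)%N by rewrite muln_gt0 t0.
have := primes_in_lower (U ^ f) s0; rewrite expnM -/U.
have e2 : (2 * 2 ^ (t * f.+1).-1 = U * U ^ f)%N.
  by rewrite -expnS prednK // expnM -/U expnS.
move: e2; move: (2 ^ (t * f.+1).-1)%N => x e2; move: (size _) => n h.
set y := (U ^ f)%N in e2 h *.
have h2 : (8 * f.+1 * t * y <= U * y)%N by rewrite leq_mul2r ht orbT.
rewrite -(leq_add2l y) -(leq_pmul2l s0); apply: leq_trans h; nia.
Qed.

(** At the scale [U = 2^t], Chebyshev's bound gives [k = U^f] candidates for moduli at most
    [U^(f+2)], so that [8 U^2] blocks of [t (f+1)] primes suffice. *)
Lemma scale_complete f t (X Q : seq nat) : (0 < t)%N -> (4 <= f)%N -> (8 * f.+2 * t <= 2 ^ t)%N ->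
  (size X <= (2 ^ t) ^ 3)%N -> {subset Q <= primes_in ((2 ^ t) ^ f.+1) ((2 ^ t) ^ f.+2)} ->
  exists H Q', [/\ uniq H, {subset H <= primes_in ((2 ^ t) ^ f) ((2 ^ t) ^ f.+1)},
     {in H, forall x, x \notin X}, (0 < size H <= (2 ^ t) ^ 3)%N &
    [/\ subseq Q' Q, (size Q <= 2 * size Q')%N & {in Q', forall q, complete q H}]].
Proof.
move=> t0 f4 ht sX sQ.
have hA : (3 * (2 ^ t) ^ f <= size (primes_in ((2 ^ t) ^ f) ((2 ^ t) ^ f.+1)))%N.
  by apply: size_primes_scale => //; apply: leq_trans ht; rewrite leq_mul2r leq_mul2l leqnSn !orbT.
have U8 : (8 <= 2 ^ t)%N by apply: leq_trans ht; nia.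
have eU : ((2 ^ t) ^ f.+1 = 2 ^ (t * f.+1))%N by rewrite expnM.
set U := (2 ^ t)%N in hA ht sX sQ U8 eU *.
pose A := [seq a <- primes_in (U ^ f) (U ^ f.+1) | a \notin X].
have uA : uniq A by rewrite filter_uniq ?uniq_primes_in.
have U0 : (0 < U)%N by apply: leq_trans U8.
have U3f : (U ^ 3 * 8 <= U ^ f)%N.
  apply: (@leq_trans (U ^ 4)); first by rewrite [X in (_ <= X)%N]expnSr leq_mul2l U8 orbT.
  by rewrite leq_pexp2l.
have hsj : (t * f.+1 * (8 * U ^ 2) <= U ^ 3)%N.
  by rewrite [X in (_ <= X)%N]expnS mulnA leq_mul2r; apply/orP; right; apply: leq_trans ht; nia.
have sA : (U ^ f + t * f.+1 * (8 * U ^ 2) <= size A)%N.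
  have hXA : (size (primes_in (U ^ f) (U ^ f.+1)) <= size X + size A)%N.
    exact: size_avoid (uniq_primes_in _ _).
  rewrite -(leq_add2l (size X)); apply: leq_trans (leq_trans hA hXA).
  apply: leq_trans (leq_add sX (leq_add (leqnn _) hsj)) _.
  by move: (U ^ f)%N (U ^ 3)%N U3f; lia.
have [||H [Q' [uH sH eH [sQ' hQ' cQ']]]] := @exists_complete Q A (U ^ f) (t * f.+1) (8 * U ^ 2) _ _ uA sA.
- rewrite -eU leq_pexp2l // andbT; apply: leq_trans U3f; rewrite leq_pmull // expn_gt0 U0 //.
- move=> q /sQ; rewrite mem_primes_in => /and3P[pq q1 q2]; split=> //.
    apply: (@leq_trans (8 * U ^ f.+2)); first by rewrite leq_mul2l q2 orbT.
    by rewrite !expnS; move: (U ^ f)%N; clear; nia.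
  move=> a; rewrite mem_filter mem_primes_in => /and4P[_ _ _ a2]; exact: leq_ltn_trans a2 q1.
exists H, Q'; split=> //.
- by move=> x /sH; rewrite mem_filter => /andP[].
- by move=> x /sH; rewrite mem_filter => /andP[].
- by rewrite eH hsj andbT !muln_gt0 t0 U0.
Qed.

(** * Adding primes to an interval *)

(** The description of the used edges is what shows that later edges are new: an edge at a
    prime outside [L] can only have been used by a gadget, and the bound on the even edges
    leaves the edges [2 P], [P] large, for the end. *)
Definition state (A Q : seq nat) (Bd : nat) (E : nat -> Prop) (L : seq nat) (s0 lo hi : rat) : Prop :=
  [/\ all prime L, uniq L, covers E L s0 lo hi &
    forall n, E n -> (gedge A Q n \/ exists p r, [/\ p \in L, r \in L, p != r & n = (p * r)%N]) /\
       (2 %| n -> n <= Bd)%N].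

Lemma state_weaken A Q Bd E L s0 lo hi lo' : lo <= lo' ->
  state A Q Bd E L s0 lo hi -> state A Q Bd E L s0 lo' hi.
Proof.
move=> h [pL uL cov hE]; split=> // v /andP[h1 h2]; apply: cov.
by rewrite h2 andbT (le_trans h).
Qed.

Lemma state_add_primes A Q Bd E L s0 lo hi (Ps : seq nat) (d : rat) : 0 <= d -> uniq Ps ->
  state A Q Bd E L s0 lo hi ->
  {in Ps, forall P, [/\ prime P, P \notin L & exists C, [/\ uniq C, {subset C <= L}, complete P C,
     \sum_(r <- C) (r * P)%:R^-1 <= d &
     {in C, forall r, ~ gedge A Q (r * P) /\ (2 %| r * P -> r * P <= Bd)%N}]]} ->
  exists E' L', state A Q Bd E' L' s0 (lo + (size Ps)%:R * d) hi /\
    (forall x, (x \in L') = (x \in Ps) || (x \in L)).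
Proof.
move=> d0; elim: Ps => [|P Ps IH] /=.
  by move=> _ st _; exists E, L; rewrite mul0r addr0.
case/andP=> PPs uPs st hPs.
have [|E' [L' [[pL' uL' cov' hE'] mL']]] := IH uPs st.
  by move=> x xPs; apply: hPs; rewrite inE xPs orbT.
have [pP PL [C [uC sC cC dC fC]]] := hPs P (mem_head _ _).
have PL' : P \notin L' by rewrite mL' negb_or PPs.
have sC' : {subset C <= L'} by move=> x /sC xL; rewrite mL' xL orbT.
have fresh n : E' n -> ~ star C P n.
  move=> /hE'[h _] [r rC en]; case: h; first by rewrite en; case: (fC r rC).
  case=> p [p' [pL1 p'L1 _ e]]; move: e; rewrite en => e.
  have [] := semiprime_inj (allP pL' r (sC' r rC)) pP (allP pL' p pL1) (allP pL' p' p'L1) e.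
    by case=> _ eP; rewrite eP p'L1 in PL'.
  by case=> _ eP; rewrite eP pL1 in PL'.
exists (fun n => E' n \/ star C P n), (P :: L'); split; last first.
  by move=> x; rewrite !inE mL' orbA.
split=> /=; [by rewrite pP | by rewrite PL' | | ].
  move=> v /andP[h1 h2] hv.
  apply: (covers_add_prime pL' pP PL' uC sC' cC fresh cov') => //; apply/andP; split=> //.
  by apply: le_trans h1; rewrite -natr1 mulrDl mul1r addrA lerD2l.
move=> n [/hE'[h1 h2]|[r rC ->]].
  split=> //; case: h1 => [|[p [r [pL1 rL1 pr ->]]]]; [by left | right].
  by exists p, r; rewrite !inE pL1 rL1 !orbT.
have [_ h2] := fC r rC; split=> //; right; exists r, P.
rewrite !inE eqxx (sC' r rC) orbT; split=> //.
by apply: contraNneq PL' => <-; apply: sC'.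
Qed.

(** By Cauchy-Davenport each nonzero residue brings at least one new sub-sum. *)
Lemma complete_units q (C : seq nat) : prime q -> {in C, forall r, ~~ (q %| r)%N} ->
  (q <= (size C).+1)%N -> complete q C.
Proof.
move=> pq hC sC; apply: completeP => //.
have fC : flatten [seq [:: r] | r <- C] = C by elim: (C) => //= r C' ->.
have := card_subsums_flatten [seq [:: r] | r <- C] pq; rewrite fC; apply: leq_trans.
rewrite leq_min leqnn /=; apply: leq_trans sC _; rewrite ltnS big_map -sum1_size !big_seq.
apply: leq_sum => r /hC; rewrite -Fp_natr_eq0 // => r0.
suff : (#|[set (0 : 'F_q)%R; (r%:R : 'F_q)^-1%R]| <= #|subsums q [:: r]|)%N.
  by rewrite cards2 eq_sym invr_eq0 r0 /=; case: #|_| => [|[]].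
apply: subset_leq_card; apply/subsetP => x /set2P[] ->; apply/subsumsP.
  by exists [::]; rewrite ?big_nil ?sub0seq.
by exists [:: r]; rewrite ?big_seq1.
Qed.

Lemma sum_leq_size (s : seq nat) M : {in s, forall x, x <= M}%N -> (\sum_(x <- s) x <= size s * M)%N.
Proof.
elim: s => [|x s IH] h; first by rewrite big_nil.
rewrite big_cons mulSn leq_add ?h ?mem_head // IH // => y ys.
by apply: h; rewrite inE ys orbT.
Qed.

Lemma prodl_leq (s : seq nat) M : {in s, forall x, x <= M}%N -> (prodl s <= M ^ size s)%N.
Proof.
rewrite /prodl; elim: s => [|x s IH] h; first by rewrite big_nil.
rewrite big_cons expnS leq_mul ?h ?mem_head // IH // => y ys.
by apply: h; rewrite inE ys orbT.
Qed.

Lemma star_cost (C : seq nat) (P a b : nat) : (0 < a)%N -> (0 < b)%N -> (b <= P)%N ->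
  {in C, forall r, a <= r}%N ->
  \sum_(r <- C) (r * P)%:R^-1 <= (size C)%:R / (a * b)%:R :> rat.
Proof.
move=> a0 b0 bP hC; apply: ler_sum_size => r /hC ar.
have h : (a * b <= r * P)%N by apply: leq_mul.
have ab : (0 < a * b)%N by rewrite muln_gt0 a0.
by rewrite lef_pV2 ?posrE ?ltr0n ?ler_nat // (leq_trans ab).
Qed.

Lemma ler_inv_muln (c x y : nat) : (0 < c)%N -> (0 < x)%N -> (c * x <= y)%N ->
  y%:R^-1 <= x%:R^-1 / c%:R :> rat.
Proof.
move=> c0 x0 xy; rewrite -invfM -natrM mulnC.
by rewrite lef_pV2 ?posrE ?ltr0n ?ler_nat ?muln_gt0 ?c0 // (leq_trans _ xy) // muln_gt0 c0.
Qed.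

(** The list [H1] lives at the scale [U^42], so there are at most about [U^46] moves; the
    slots live at [U^54]. The interval starts below [2 / U^3] and has length at least [U^-10],
    which depends only polynomially on [U] because the product of all
    the primes in [A] has at most [U^4] binary digits. *)
Lemma core_state t : (0 < t)%N -> (440 * t <= 2 ^ t)%N ->
  let U := (2 ^ t)%N in
  exists H1 P23 Q1 Q s0 lo hi,
    let A := (2 :: H1) ++ P23 in
    [/\ [/\ all prime A, uniq A, {in A, forall a, a <= U ^ 54}%N, (size A <= U ^ 4)%N &
           {in H1, forall h, (U ^ 41 < h <= U ^ 42)%N}],
        [/\ uniq Q1, {subset Q1 <= primes_in (U ^ 42) (U ^ 43)}, (U ^ 42 <= size Q1)%N,
           {in Q1, forall P, complete P H1} & (size H1 <= U ^ 3)%N],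
        {subset Q <= primes_in (U ^ 54) (U ^ 55)},
        s0 * (prodl A)%:R \is a Num.int /\ covers (gedge A Q) (2 :: H1) s0 lo hi &
        lo <= 2 / (U ^ 3)%:R /\ lo + (U ^ 10)%:R^-1 <= hi].
Proof.
move=> t0 ht U.
have U440 : (440 <= U)%N by apply: leq_trans ht; rewrite leq_pmulr.
have U0 : (0 < U)%N by apply: leq_trans U440.
have pU i j : (i <= j)%N -> (U ^ i <= U ^ j)%N by move=> ij; rewrite leq_pexp2l.
have pU0 i : (0 < U ^ i)%N by rewrite expn_gt0 U0.
have hsc c : (c <= 440)%N -> (c * t <= U)%N by move=> h; apply: leq_trans ht; rewrite leq_mul2r h orbT.
have [|H1 [Q1 [uH1 sH1 _ /andP[H10 H13] [sQ1 hQ1 cQ1]]]] := @scale_complete 41 t [::]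
    (primes_in (U ^ 42) (U ^ 43)) t0 isT (hsc 344 isT) (leq0n _).
  by move=> x.
have [|P2 [Q2 [uP2 sP2 _ /andP[_ P23] [sQ2 hQ2 cQ2]]]] := @scale_complete 53 t [::]
    (primes_in (U ^ 54) (U ^ 55)) t0 isT (hsc 440 isT) (leq0n _).
  by move=> x.
have [|P3 [Q3 [uP3 sP3 dP3 /andP[_ P33] [sQ3 hQ3 cQ3]]]] := @scale_complete 53 t P2 Q2
    t0 isT (hsc 440 isT) P23.
  by move=> x /(mem_subseq sQ2).
have hQ54 : (3 * U ^ 54 <= size (primes_in (U ^ 54) (U ^ 55)))%N.
  by apply: size_primes_scale => //; apply: hsc.
have hQ42 : (3 * U ^ 42 <= size (primes_in (U ^ 42) (U ^ 43)))%N.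
  by apply: size_primes_scale => //; apply: hsc.
have m1 h : h \in H1 -> [&& prime h, (U ^ 41 < h)%N & (h <= U ^ 42)%N].
  by move=> /sH1; rewrite mem_primes_in.
have m2 h : h \in P2 ++ P3 -> [&& prime h, (U ^ 53 < h)%N & (h <= U ^ 54)%N].
  by rewrite mem_cat => /orP[/sP2|/sP3]; rewrite mem_primes_in.
have m3 q : q \in Q3 -> [&& prime q, (U ^ 54 < q)%N & (q <= U ^ 55)%N].
  by move=> /(mem_subseq sQ3) /(mem_subseq sQ2); rewrite mem_primes_in.
pose L := 2 :: H1; pose A := L ++ P2 ++ P3.
have U41 : (2 <= U ^ 41)%N.
  by apply: leq_trans (pU 1 41 isT); rewrite expn1; lia.
have mL p : p \in L -> prime p && (p <= U ^ 42)%N.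
  rewrite inE => /orP[/eqP->|/m1/and3P[-> _ ->]] //=.
  by apply: leq_trans U41 (pU 41 42 isT).
have pA : all prime A.
  apply/allP => p; rewrite mem_cat => /orP[/mL/andP[]|/m2/and3P[]] //.
have uL : uniq L.
  rewrite /= uH1 andbT; apply/negP => /m1/and3P[_ h _].
  by have := leq_trans h U41; rewrite ltnn.
have u23 : uniq (P2 ++ P3).
  by rewrite cat_uniq uP2 uP3 andbT; apply/hasPn.
have uA : uniq A.
  rewrite cat_uniq uL u23 andbT; apply/hasPn => p /m2/and3P[_ h _]; apply/negP => /mL/andP[_ h'].
  by have := leq_trans h (leq_trans h' (pU 42 53 isT)); rewrite ltnn.
have mA p : p \in A -> (p <= U ^ 54)%N.
  rewrite mem_cat => /orP[/mL/andP[_ h]|/m2/and3P[]] //; exact: leq_trans h (pU _ _ _).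
have U34 : (440 * U ^ 3 <= U ^ 4)%N by rewrite [X in (_ <= X)%N]expnS leq_mul2r U440 orbT.
have sA : (size A <= 4 * U ^ 3)%N.
  rewrite !size_cat [size L]/=; move: (pU0 3) H13 P23 P33; clear.
  by move: (U ^ 3)%N (size H1) (size P2) (size P3); lia.
exists H1, (P2 ++ P3), Q1, Q3.
have uQ3 : uniq Q3 by apply: subseq_uniq sQ3 (subseq_uniq sQ2 (uniq_primes_in _ _)).
(* The translations reach up to [K / m], about [U^-9]. *)
pose m := prodl L; pose K := (m %/ U ^ 9)%N.
have pL : all prime L by apply/allP => p /mL/andP[].
have small : \sum_(r <- P2 ++ P3) r%:R^-1 <= 1 / 2 :> rat.
  apply: (@le_trans _ _ ((size (P2 ++ P3))%:R / (U ^ 53)%:R)).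
    apply: ler_sum_size => r /m2/and3P[_ h _].
    by rewrite lef_pV2 ?posrE ?ltr0n ?(leq_trans _ h) // ler_nat ltnW.
  rewrite ler_pdivrMr ?ltr0n // mul1r ler_pdivlMl // -natrM ler_nat size_cat.
  have := pU 3 53 isT; have : (440 * U ^ 52 <= U ^ 53)%N by rewrite [X in (_ <= X)%N]expnS leq_mul2r U440 orbT.
  have := pU 3 52 isT; move: P23 P33; clear.
  by move: (U ^ 3)%N (U ^ 52)%N (U ^ 53)%N (size P2) (size P3); lia.
have mU : (U ^ 41 <= m)%N.
  case: H1 H10 @L @m {sH1 uH1 H13 cQ1 mL uL uA mA sA pA A K pL} m1 => // h H1 _ L m m1.
  have := m1 h (mem_head _ _); case/and3P=> _ /ltnW h1 _; apply: leq_trans h1 _.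
  rewrite /m /L /prodl !big_cons mulnCA leq_pmulr // muln_gt0 /= prodl_gt0 //.
  by apply/allP => x xH; have /and3P[] := m1 x (mem_behead (s := h :: H1) xH).
have KU : (U ^ 9 * K <= m)%N by rewrite mulnC leq_divM.
(* Gain [U^46], growth rate [1 + U^-47] and [U^4] doublings: [2 U^51] slots out of about [U^54]. *)
have [|||||s0 [hs0 hlo cov]] := @core_interval L P2 P3 Q3 (U ^ 54) K (U ^ 46) (U ^ 47) (U ^ 4)
    pA uA small (mem_head _ _) uQ3.
- move=> q qQ; have /and3P[pq q1 q2] := m3 q qQ; split=> //; first 1 last.
  + exact: ltnW.
  + apply: (@leq_trans (U ^ 46 * (U ^ 9 * K))); last by rewrite leq_mul2l KU orbT.
    by rewrite mulnA -expnD leq_mul2r q2 orbT.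
  + by split; [apply: cQ2; apply: (mem_subseq sQ3) | apply: cQ3].
  by apply/negP => /mA h; have := leq_trans q1 h; rewrite ltnn.
- have h1 : (\sum_(p <- L) p <= 2 + U ^ 45)%N.
    rewrite big_cons leq_add2l; apply: leq_trans (sum_leq_size (M := U ^ 42) _) _.
      by move=> x /m1/and3P[].
    by rewrite (_ : 45 = 3 + 42)%N // expnD leq_mul2r H13 orbT.
  have h2 := pU 45 46 isT; have h3 := pU 3 46 isT; have h4 := pU0 3; have h6 := pU0 46.
  have h5 : (440 * U ^ 46 <= U ^ 47)%N by rewrite [X in (_ <= X)%N]expnS leq_mul2r U440 orbT.
  move: h1 H13 h2 h3 h4 h5 h6; rewrite /L /=; clear.
  by move: (\sum_(_ <- _) _)%N (size H1) (U ^ 3)%N (U ^ 45)%N (U ^ 46)%N (U ^ 47)%N; lia.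
- have A0 : (0 < prodl A)%N by apply: prodl_gt0.
  have h1 : (prodl A <= 2 ^ (216 * t * U ^ 3))%N.
    have e (x : nat) : (216 * t * x = t * (54 * (4 * x)))%N by clear -t x; lia.
    apply: leq_trans (prodl_leq mA) _; rewrite -expnM -expnM (leq_exp2l _ _ (ltnSn 1)) e.
    by rewrite leq_mul // leq_mul.
  apply: (@leq_trans (2 ^ (216 * t * U ^ 3 + 2))).
    rewrite expnD; have := pU0 3; have : (0 < 2 ^ (216 * t * U ^ 3))%N by rewrite expn_gt0.
    by move: h1; clear; move: (prodl A) (2 ^ _)%N; lia.
  rewrite (leq_exp2l _ _ (ltnSn 1)) [X in (_ <= X)%N]expnS.
  move: (pU0 3) (ht : (440 * t <= U)%N) t0; move: (U ^ 3)%N => x; clear -U.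
  by move: U => u; nia.
- have e : (U ^ 47 * U ^ 4 = U ^ 51)%N by rewrite -expnD.
  rewrite e; have := pU 51 53 isT.
  have : (440 * U ^ 53 <= U ^ 54)%N by rewrite [X in (_ <= X)%N]expnS leq_mul2r U440 orbT.
  move: hQ2 hQ3 hQ54; clear.
  by move: (size Q2) (size Q3) (size _) (U ^ 51)%N (U ^ 53)%N (U ^ 54)%N; lia.
- by rewrite -expnD pU.
exists s0, (s0 + K%:R / m%:R), (s0 + (K + K./2)%:R / m%:R) => A'.
split.
- split=> //; first by apply: leq_trans sA (leq_trans _ U34); rewrite leq_mul2r orbT.
  by move=> h /m1/and3P[_ -> ->].
- split=> //; [exact: subseq_uniq sQ1 (uniq_primes_in _ _) | by move=> x /(mem_subseq sQ1) |].
  by move: hQ1 hQ42; clear; move: (size Q1) (size _) (U ^ 42)%N; lia.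
- by move=> q /m3 h; rewrite mem_primes_in.
- by [].
split.
  have e51 : (U ^ 47 * U ^ 4 = U ^ 51)%N by rewrite -expnD.
  have e54 : (U ^ 54 = U ^ 51 * U ^ 3)%N by rewrite -expnD.
  move: hlo; rewrite e51 e54 (natrM _ 2) (natrM _ (U ^ 51) (U ^ 3)) => hlo; apply: le_trans hlo _.
  have : (U ^ 51)%:R != 0 :> rat by rewrite pnatr_eq0 -lt0n.
  have : (U ^ 3)%:R != 0 :> rat by rewrite pnatr_eq0 -lt0n.
  move: (U ^ 51)%:R (U ^ 3)%:R => x y y0 x0.
  by rewrite (_ : 2 * x / (x * y) = 2 / y) //; field; rewrite x0 y0.
have m0 : (0 < m)%N by apply: prodl_gt0.
rewrite -addrA lerD2l natrD mulrDl lerD2l.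
rewrite ler_pdivlMr ?ltr0n // ler_pdivrMl ?ltr0n // -natrM ler_nat.
have h1 : (m < U ^ 9 + K * U ^ 9)%N by rewrite -mulSn; apply: ltn_ceil.
have h2 : (440 * U ^ 9 <= U ^ 10)%N by rewrite [X in (_ <= X)%N]expnS leq_mul2r U440 orbT.
have h3 := leq_trans (pU 10 41 isT) mU.
have /(_ K) h4 : forall n, (n <= n./2 * 2 + 1)%N by clear; move=> n; lia.
move: h1 h2 h3 h4; clearbody K m; clear.
move: K m K./2 (U ^ 10)%N (U ^ 9)%N; clear => K m k x y h1 h2 h3 h4.
have a := leq_mul h4 (leqnn y); have b := leq_mul h2 (leqnn k).
apply: leq_trans b; nia.
Qed.

(** Linking the primes of [Q1] to [H1] costs [U^-37] in all. A small prime [p] is then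
    linked to [p - 1] primes of [Q1]; up to [U^30] this costs at most [U^-12]. *)
Lemma base_state t : (0 < t)%N -> (440 * t <= 2 ^ t)%N ->
  let U := (2 ^ t)%N in
  exists A Q E L s0 lo hi,
    [/\ [/\ all prime A, uniq A, {in A, forall a, a <= U ^ 54}%N, (size A <= U ^ 4)%N & 2 \in A],
        {subset Q <= primes_in (U ^ 54) (U ^ 55)},
        s0 * (prodl A)%:R \is a Num.int,
        state A Q (U ^ 109) E L s0 lo hi /\ (forall p, prime p -> (p <= U ^ 30)%N -> p \in L) &
        lo <= 3 / U%:R /\ lo + 2 / (U ^ 11)%:R <= hi].
Proof.
move=> t0 ht U.
have [H1 [P23 [Q1 [Q [s0 [lo [hi [hA hQ1 hQ [hs0 cov] [hlo hhi]]]]]]]]] := core_state t0 ht.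
rewrite -/U in hA hQ1 hQ hlo hhi.
set A := (2 :: H1) ++ P23 in hA hs0 cov.
case: hA => pA uA mA sA mH1; case: hQ1 => uQ1 sQ1 szQ1 cQ1 szH1.
have U440 : (440 <= U)%N by apply: leq_trans ht; rewrite leq_pmulr.
have U0 : (0 < U)%N by apply: leq_trans U440.
have pU i j : (i <= j)%N -> (U ^ i <= U ^ j)%N by move=> ij; rewrite leq_pexp2l.
have pU0 i : (0 < U ^ i)%N by rewrite expn_gt0 U0.
have mQ1 P : P \in Q1 -> [&& prime P, (U ^ 42 < P)%N & (P <= U ^ 43)%N].
  by move=> /sQ1; rewrite mem_primes_in.
have mQ q : q \in Q -> [&& prime q, (U ^ 54 < q)%N & (q <= U ^ 55)%N].
  by move=> /hQ; rewrite mem_primes_in.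
have nogadget r P : prime r -> prime P -> (r <= U ^ 43)%N -> (P <= U ^ 43)%N ->
    ~ gedge A Q (r * P) /\ (2 %| r * P -> r * P <= U ^ 109)%N.
  move=> pr pP rU PU; split; last first.
    move=> _; apply: (@leq_trans (U ^ 43 * U ^ 43)); first exact: leq_mul.
    by rewrite -expnD pU.
  case=> q qQ [p pA' e]; have /and3P[pq q1 _] := mQ q qQ.
  have h43 := pU 43 54 isT.
  have [] := semiprime_inj pr pP (allP pA p pA') pq e => [[_ e']|[e' _]].
    by have := leq_trans (leq_trans q1 (eq_leq (esym e'))) (leq_trans PU h43); rewrite ltnn.
  by have := leq_trans (leq_trans q1 (eq_leq (esym e'))) (leq_trans rU h43); rewrite ltnn.
have st0 : state A Q (U ^ 109) (gedge A Q) (2 :: H1) s0 lo hi.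
  split=> //.
  - by move: pA; rewrite all_cat => /andP[].
  - by move: uA; rewrite cat_uniq => /and3P[].
  - move=> n h; split; first by left.
    move=> _; case: h => q qQ [p pA' ->]; have /and3P[_ _ q2] := mQ q qQ.
    by apply: (leq_trans (leq_mul (mA p pA') q2)); rewrite -expnD.
have U41 : (2 <= U ^ 41)%N.
  by apply: leq_trans (pU 1 41 isT); rewrite expn1; apply: leq_trans U440.
have [||E1 [L1 [st1 mL1]]] := @state_add_primes A Q (U ^ 109) _ _ s0 lo hi Q1
    ((U ^ 3)%:R / (U ^ 41 * U ^ 42)%:R) _ uQ1 st0.
- by rewrite divr_ge0.
- move=> P PQ; have /and3P[pP P1 P2] := mQ1 P PQ; split=> //.
    rewrite inE negb_or; apply/andP; split.
      apply: contraTneq P1 => ->; rewrite -leqNgt; exact: leq_trans U41 (pU 41 42 isT).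
    by apply/negP => /mH1/andP[_ h]; have := leq_trans P1 h; rewrite ltnn.
  exists H1; split.
  + by move: uA; rewrite /= cat_uniq => /andP[_ /and3P[]].
  + by move=> x xH; rewrite inE xH orbT.
  + exact: cQ1.
  + apply: le_trans (star_cost (a := U ^ 41) (b := U ^ 42) _ _ _ _) _ => //; first exact: ltnW.
      by move=> r /mH1/andP[/ltnW].
    by rewrite ler_pM2r ?ler_nat // invr_gt0 ltr0n -expnD.
  move=> r rH; have /andP[_ r2] := mH1 r rH; apply: nogadget => //.
    by apply: (allP pA); rewrite mem_cat inE rH orbT.
  exact: leq_trans r2 (pU 42 43 isT).
pose Ps := [seq p <- primes_in 0 (U ^ 30) | p \notin L1].
have uPs : uniq Ps by rewrite filter_uniq ?uniq_primes_in.
have [||E2 [L2 [st2 mL2]]] := @state_add_primes A Q (U ^ 109) _ _ s0 _ hi Ps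
    ((U ^ 42)%:R^-1) _ uPs st1.
- by rewrite invr_ge0.
- move=> p; rewrite mem_filter mem_primes_in => /and4P[pL1 pp _ p30]; split=> //.
  have p42 := leq_trans p30 (pU 30 42 isT).
  have sC : size (take p.-1 Q1) = p.-1.
    by rewrite size_takel //; apply: leq_trans (leq_pred p) (leq_trans p42 szQ1).
  have mC r : r \in take p.-1 Q1 -> r \in Q1 by apply: mem_take.
  exists (take p.-1 Q1); split.
  + exact: take_uniq.
  + by move=> x /mC; rewrite mL1 => ->.
  + apply: complete_units => //; last by rewrite sC prednK ?prime_gt0.
    move=> r /mC rQ; have /and3P[pr r1 _] := mQ1 r rQ; rewrite dvdn_prime2 //.
    by apply: contraTneq r1 => <-; rewrite -leqNgt.
  + apply: le_trans (star_cost (a := U ^ 42) (b := p) _ _ _ _) _ => //; first exact: prime_gt0.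
      by move=> r /mC rQ; have /and3P[_ /ltnW] := mQ1 r rQ.
    have p0 : 0 < p%:R :> rat by rewrite ltr0n prime_gt0.
    have u0 : 0 < (U ^ 42)%:R :> rat by rewrite ltr0n.
    rewrite sC natrM invfM mulrCA -[X in _ <= X]mulr1 ler_pM2l ?invr_gt0 //.
    by rewrite ler_pdivrMr // mul1r ler_nat leq_pred.
  move=> r /mC rQ; have /and3P[pr _ r2] := mQ1 r rQ; apply: nogadget => //.
  exact: leq_trans p30 (pU 30 43 isT).
exists A, Q, E2, L2, s0, (lo + (size Q1)%:R * ((U ^ 3)%:R / (U ^ 41 * U ^ 42)%:R) +
   (size Ps)%:R * (U ^ 42)%:R^-1), hi; split=> //.
  split=> // p pp p30; rewrite mL2 mem_filter mem_primes_in pp p30 prime_gt0 //=.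
  by case: (p \in L1); rewrite ?orbT.
have c1 : (size Q1)%:R * ((U ^ 3)%:R / (U ^ 41 * U ^ 42)%:R) <= (U ^ 12)%:R^-1 :> rat.
  have hs : (size Q1 <= U ^ 43)%N.
    have := uniq_leq_size uQ1 sQ1; move/leq_trans; apply.
    by rewrite size_filter; apply: leq_trans (count_size _ _) _; rewrite size_iota leq_subr.
  have h0 : (0 < U ^ 41 * U ^ 42)%N by rewrite -expnD.
  rewrite mulrA -natrM ler_pdivrMr ?ltr0n //.
  rewrite mulrC ler_pdivlMr ?ltr0n // -natrM ler_nat.
  apply: (leq_trans (leq_mul (leq_mul hs (leqnn _)) (leqnn _))).
  by rewrite -!expnD pU.
have c2 : (size Ps)%:R * (U ^ 42)%:R^-1 <= (U ^ 12)%:R^-1 :> rat.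
  have hPs : (size Ps <= U ^ 30)%N.
    rewrite size_filter; apply: leq_trans (count_size _ _) _.
    by rewrite size_filter; apply: leq_trans (count_size _ _) _; rewrite size_iota subn0.
  rewrite ler_pdivrMr ?ltr0n // mulrC ler_pdivlMr ?ltr0n // -natrM ler_nat.
  by apply: (leq_trans (leq_mul hPs (leqnn _))); rewrite -expnD.
have c3 : (U ^ 3)%:R^-1 <= U%:R^-1 :> rat.
  by rewrite lef_pV2 ?posrE ?ltr0n // ler_nat -{1}(expn1 U) pU.
have mul440 i : (440 * U ^ i <= U ^ i.+1)%N by rewrite expnS leq_mul2r U440 orbT.
have c4 : (U ^ 12)%:R^-1 <= (U ^ 11)%:R^-1 / 440%:R :> rat by apply: ler_inv_muln.
have c5 : (U ^ 11)%:R^-1 <= (U ^ 10)%:R^-1 / 440%:R :> rat by apply: ler_inv_muln.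
have c6 : (U ^ 11)%:R^-1 <= U%:R^-1 :> rat.
  by rewrite lef_pV2 ?posrE ?ltr0n // ler_nat -{1}(expn1 U) pU.
have c7 : 0 < (U ^ 11)%:R^-1 :> rat by rewrite invr_gt0 ltr0n.
move: c1 c2; set x1 := (size Q1)%:R * _; set x2 := (size Ps)%:R * _ => c1 c2.
move: c1 c2 c3 c4 c5 c6 c7 hlo hhi; clearbody x1 x2; clear.
move: ((U ^ 12)%:R^-1) ((U ^ 11)%:R^-1) ((U ^ 10)%:R^-1) ((U ^ 3)%:R^-1) (U%:R^-1).
by move=> u12 u11 u10 u3 u1; lra.
Qed.

(** * Adding all primes *)

Lemma expn2_half i : (2 ^ i./2 * 2 ^ i./2 <= 2 ^ i)%N.
Proof. by rewrite -expnD leq_exp2l //; lia. Qed.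

(** Chebyshev's bound gives about [2^i / (2 i)] candidates for the modulus [P <= 2^(i+1)], so
    [64 i] blocks of [i] primes suffice. Keeping them above [2^(i/2)] makes their edges at [P] short. *)
Lemma dyadic_complete i (X : seq nat) P : (0 < i)%N -> (1000 * i ^ 3 <= 2 ^ i./2)%N ->
  (size X <= 2 ^ i./2)%N -> prime P -> (2 ^ i < P <= 2 ^ i.+1)%N ->
  exists C, [/\ uniq C, {subset C <= primes_in (2 ^ i./2) (2 ^ i)}, {in C, forall r, r \notin X},
    size C = (i * (64 * i))%N & complete P C].
Proof.
move=> i0 hi sX pP /andP[P1 P2].
pose A := [seq r <- primes_in (2 ^ i./2) (2 ^ i) | r \notin X].
have uA : uniq A by rewrite filter_uniq ?uniq_primes_in.
(* Half of what Chebyshev's bound guarantees, to leave room for [X] and the small primes. *)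
pose k := (2 ^ i %/ (4 * i)).+1.
have i40 : (0 < 4 * i)%N by rewrite muln_gt0.
have k1 : (2 ^ i < k * (4 * i))%N by apply: ltn_ceil.
have k2 : (k * (4 * i) <= 2 ^ i + 4 * i)%N by rewrite mulSn [(2 ^ i + _)%N]addnC leq_add2l leq_divM.
have hZ := expn2_half i.
have hA : (2 ^ i.-1 <= i * (2 ^ i./2 + (size X + size A)))%N.
  apply: leq_trans (primes_in_lower (2 ^ i./2) i0) _.
  rewrite leq_mul2l leq_add2l; apply/orP; right; exact: size_avoid (uniq_primes_in _ _).
have e2 : (2 ^ i = 2 * 2 ^ i.-1)%N by rewrite -expnS prednK.
have e3 : (i ^ 3 = i * (i * i))%N by rewrite !expnS expn0 muln1.
rewrite e3 in hi.
have h3 : (1 <= i * i)%N by rewrite muln_gt0 i0.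
have h5 : (i <= i * (i * i))%N by rewrite leq_pmulr.
have [|||H [Q' [uH sH eH [sQ' hQ' cQ']]]] := @exists_complete [:: P] A k i (64 * i) _ _ uA _.
- clear -k1 k2 hZ hi i0 h3 h5.
  move: k1 k2 hZ hi h5; move: (2 ^ i)%N (2 ^ i./2)%N k (i * (i * i))%N => y z k w.
  clear -i0 => k1 k2 hZ hi wi.
  have h6 : (1000 * z <= y)%N by apply: leq_trans hZ; rewrite leq_mul2r; apply/orP; right; lia.
  have h7 : (1000 * i <= z)%N by lia.
  by apply/andP; split; nia.
- move=> q; rewrite inE => /eqP->; split=> //.
    apply: (@leq_trans (8 * 2 ^ i.+1)); first by rewrite leq_mul2l P2 orbT.
    by rewrite expnS; clear -k1; move: k1; move: (2 ^ i)%N k; clear; lia.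
  by move=> a; rewrite mem_filter mem_primes_in => /and4P[_ _ _ h]; apply: leq_ltn_trans P1.
- clear -sX k2 hZ hi i0 h3 h5 hA e2.
  move: sX k2 hZ hi hA; rewrite e2.
  move: (2 ^ i.-1)%N (2 ^ i./2)%N (size X) (size A) k => y z x n k.
  clear -i0 h3 h5 => sX k2 hZ hi hA.
  have h1 : (1000 * (i * (i * i)) * z <= z * z)%N by rewrite leq_mul2r hi orbT.
  have h4 : (i * z <= i * (i * i) * z)%N by rewrite leq_mul2r leq_pmulr ?orbT.
  have h7 : (z <= i * z)%N by rewrite leq_pmull.
  have h8 : (i * x <= i * z)%N by rewrite leq_mul2l sX orbT.
  have h9 : (i * (i * i) <= i * (i * i) * z)%N by rewrite leq_pmulr; [ | lia].
  rewrite -(leq_pmul2l i0); lia.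
have Q'P : P \in Q'.
  case: (Q') sQ' hQ' => // q Q'' sQ _; have := mem_subseq sQ (mem_head _ _).
  by rewrite inE => /eqP <-; apply: mem_head.
exists H; split=> //; [ | | exact: cQ'].
- by move=> r /sH; rewrite mem_filter => /andP[].
- by move=> r /sH; rewrite mem_filter => /andP[].
Qed.

Lemma state_dyadic_step A Q Bd E L s0 lo hi i : (0 < i)%N -> (1000 * i ^ 3 <= 2 ^ i./2)%N ->
  (size A <= 2 ^ i./2)%N -> 2 \in A -> all prime A ->
  {in Q, forall q, prime q /\ {in A, forall a, a < q}%N} ->
  state A Q Bd E L s0 lo hi -> (forall p, prime p -> (p <= 2 ^ i)%N -> p \in L) ->
  exists E' L', state A Q Bd E' L' s0 (lo + (i * (64 * i))%:R / (2 ^ i./2)%:R) hi /\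
    (forall p, prime p -> (p <= 2 ^ i.+1)%N -> p \in L').
Proof.
move=> i0 hiZ sA A2 pA hQ st hL.
pose Ps := [seq P <- primes_in (2 ^ i) (2 ^ i.+1) | P \notin L].
have uPs : uniq Ps by rewrite filter_uniq ?uniq_primes_in.
have z0 : (0 < 2 ^ i./2)%N by rewrite expn_gt0.
have y0 : (0 < 2 ^ i)%N by rewrite expn_gt0.
pose d : rat := (i * (64 * i))%:R / (2 ^ i./2 * 2 ^ i)%:R.
have d0 : 0 <= d by rewrite divr_ge0.
have [|E' [L' [st' mL']]] := state_add_primes d0 uPs st.
  move=> P; rewrite mem_filter mem_primes_in => /and4P[PL pP P1 P2]; split=> //.
  have [|C [uC sC dC eC cC]] := dyadic_complete i0 hiZ sA pP; first by rewrite P1.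
  have mC r : r \in C -> [&& prime r, (2 ^ i./2 < r)%N & (r <= 2 ^ i)%N].
    by move=> /sC; rewrite mem_primes_in.
  exists C; split=> //.
  - by move=> r /mC/and3P[pr _ h]; apply: hL.
  - rewrite /d -eC; apply: star_cost => //; first exact: ltnW.
    by move=> r /mC/and3P[_ /ltnW].
  move=> r rC; have /and3P[pr r1 r2] := mC r rC; split.
    case=> q qQ [p pA' e]; have [pq hq] := hQ q qQ.
    have [] := semiprime_inj pr pP (allP pA p pA') pq e => [[e' _]|[e1 e3]].
      by have := dC r rC; rewrite e' pA'.
    by have := hq p pA'; rewrite -e1 -e3 ltnNge ltnW // (leq_ltn_trans r2 P1).
  rewrite Euclid_dvdM // !dvdn_prime2 // => /orP[] /eqP e.
    by have := dC r rC; rewrite -e A2.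
  by move: P1; rewrite -e ltnNge -{1}(expn1 2) leq_exp2l // i0.
exists E', L'; split.
  apply: state_weaken st'; rewrite lerD2l.
  have sPs : (size Ps <= 2 ^ i)%N.
    rewrite size_filter; apply: leq_trans (count_size _ _) _.
    rewrite size_filter; apply: leq_trans (count_size _ _) _; rewrite size_iota.
    by rewrite expnS mul2n -addnn addnK.
  apply: (@le_trans _ _ ((2 ^ i)%:R * d)); first by rewrite ler_wpM2r // ler_nat.
  rewrite /d (natrM _ (2 ^ i./2)).
  have : (2 ^ i)%:R != 0 :> rat by rewrite pnatr_eq0 -lt0n.
  have : (2 ^ i./2)%:R != 0 :> rat by rewrite pnatr_eq0 -lt0n.
  move: ((2 ^ i)%:R : rat) ((2 ^ i./2)%:R : rat) ((i * (64 * i))%:R : rat) => y z x z1 y1.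
  by rewrite (_ : y * _ = x / z) //; field; rewrite y1 z1.
move=> p pp p2; rewrite mL' mem_filter mem_primes_in pp p2 !andbT /=.
have [h|h] := leqP p (2 ^ i); first by rewrite hL ?orbT.
by case: (p \in L); rewrite ?orbT.
Qed.

(** The cost of the step [i] is bounded by a telescoping difference. *)
Lemma state_all_primes A Q Bd E L s0 lo hi i0 (c : rat) n : (0 < i0)%N -> 2 \in A -> all prime A ->
  {in Q, forall q, prime q /\ {in A, forall a, a < q}%N} ->
  (forall i, (i0 <= i)%N -> [/\ (1000 * i ^ 3 <= 2 ^ i./2)%N, (size A <= 2 ^ i./2)%N &
     (i * (64 * i))%:R / (2 ^ i./2)%:R <= c * (i%:R^-1 - i.+1%:R^-1)]) ->
  state A Q Bd E L s0 lo hi -> (forall p, prime p -> (p <= 2 ^ i0)%N -> p \in L) ->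
  exists E' L', state A Q Bd E' L' s0 (lo + c * (i0%:R^-1 - (i0 + n)%:R^-1)) hi /\
    (forall p, prime p -> (p <= 2 ^ (i0 + n))%N -> p \in L').
Proof.
move=> i00 A2 pA hQ hcost st hL; elim: n => [|n [E' [L' [st' hL']]]].
  by exists E, L; rewrite addn0 subrr mulr0 addr0.
have [h1 h2 h3] := hcost (i0 + n)%N (leq_addr _ _).
have [|E2 [L2 [st2 hL2]]] := state_dyadic_step _ h1 h2 A2 pA hQ st' hL'.
  by rewrite addn_gt0 i00.
exists E2, L2; rewrite addnS; split=> //; apply: state_weaken st2.
move: h3; move: (_ / _) => x; move: ((i0 + n)%:R^-1) ((i0 + n).+1%:R^-1) (i0%:R^-1) => u v w h3.
by rewrite -addrA lerD2l; lra.
Qed.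

(** The reciprocals of these edges have a divergent sum: they push [hi] beyond any bound. *)
Lemma covers_add_even_edges E L s0 lo hi (Rs : seq nat) : all prime L -> uniq L -> 2 \in L ->
  s0 * (prodl L)%:R \is a Num.int -> uniq Rs ->
  {in Rs, forall P, [/\ P \in L, P != 2, (2 * P)%:R^-1 <= hi - lo & ~ E (2 * P)%N]} ->
  covers E L s0 lo hi ->
  covers (fun n => E n \/ exists2 P, P \in Rs & n = (2 * P)%N) L s0 lo
    (hi + \sum_(P <- Rs) (2 * P)%:R^-1).
Proof.
move=> pL uL L2 hs0 + + cov; elim: Rs => [|P Rs IH] /=.
  move=> _ _ v; rewrite big_nil addr0 => h1 h2.
  by apply: egyptian_sub (cov v h1 h2) => n; left.
case/andP=> PR uR hR.
have {}IH := IH uR (fun x h => hR x (@mem_behead _ (P :: Rs) x h)).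
have [PL P2 hP EP] := hR P (mem_head _ _).
have pP := allP pL P PL.
have s_ge0 : 0 <= \sum_(P <- Rs) (2 * P)%:R^-1 :> rat.
  by apply: sumr_ge0 => i _; rewrite invr_ge0.
have h2 : (2 * P %| prodl L)%N.
  rewrite (_ : (2 * P)%N = prodl [:: 2; P]); last by rewrite /prodl !big_cons big_nil muln1.
  apply: prodl_dvd; rewrite //= ?inE 1?eq_sym ?P2 // => x.
  by rewrite !inE => /orP[] /eqP ->.
have hfresh : ~ (E (2 * P)%N \/ exists2 P0, P0 \in Rs & (2 * P)%N = (2 * P0)%N).
  case=> // -[P0 P0R /eqP]; rewrite eqn_pmul2l // => /eqP e; by rewrite e P0R in PR.
have h3 : (0 < 2 * P)%N by rewrite muln_gt0 (prime_gt0 pP).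
have h4 : (2 * P)%:R^-1 <= hi + \sum_(P <- Rs) (2 * P)%:R^-1 - lo by lra.
have := covers_add_edge IH hfresh hs0 h2 h3 h4.
move=> cov' v h5 h6; rewrite big_cons addrA [hi + _]addrC -addrA addrC in h5.
apply: egyptian_sub (cov' v h5 h6) => n [[En|[P0 P0R ->]]|->]; first by left.
  by right; exists P0; rewrite // inE P0R orbT.
by right; exists P; rewrite // mem_head.
Qed.

(** * The theorem *)

Lemma squarefree_dvd_prodl b L : (0 < b)%N -> squarefree b -> uniq L ->
  (forall p, prime p -> (p %| b)%N -> p \in L) -> (b %| prodl L)%N.
Proof.
move=> b0 sqf uL hL.
have -> : b = prodl (primes b).
  rewrite {1}(prod_prime_decomp b0) prime_decompE big_map /prodl big_seq [RHS]big_seq.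
  apply: eq_bigr => p /=; rewrite mem_primes => /and3P[pp _ pb].
  have l1 : (0 < logn p b)%N by rewrite logn_gt0 mem_primes pp b0.
  suff -> : logn p b = 1%N by rewrite expn1.
  apply/eqP; rewrite eqn_leq l1 andbT leqNgt; apply/negP => l2.
  have /sqf p1 : (p ^ 2 %| b)%N by rewrite pfactor_dvdn.
  by rewrite p1 in pp.
apply: prodl_dvd => //; first exact: primes_uniq.
by move=> p; rewrite mem_primes => /and3P[pp _ pb]; apply: hL.
Qed.

Lemma egyptian_increasing (E : nat -> Prop) (v : rat) : 0 < v ->
  (forall n, E n -> product_of_two_distinct_primes n) -> egyptian E v ->
  exists (k : nat) (n : 'I_k -> nat),
    [/\ (1 <= k)%N,
        forall i : 'I_k, (1 < n i)%N,
        forall i j : 'I_k, (i < j)%N -> (n i < n j)%N,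
        forall i : 'I_k, product_of_two_distinct_primes (n i)
      & v = \sum_(i < k) (n i)%:R^-1 :> rat].
Proof.
move=> v0 hE [s [us hs ev]].
pose s' := sort leq s.
have hs' (i : 'I_(size s')) : product_of_two_distinct_primes (nth 0%N s' i).
  by apply: hE; apply: hs; rewrite -(mem_sort leq) mem_nth.
exists (size s'), (fun i => nth 0%N s' i); split=> //.
- rewrite size_sort; case: s ev {us hs s' hs'} => // ev; by rewrite ev big_nil ltxx in v0.
- move=> i; have [p [q [pp pq _ ->]]] := hs' i.
  by have := leq_mul (prime_gt1 pp) (prime_gt0 pq); rewrite muln1.
- move=> i j ij; have hlt : sorted ltn s'.
    by rewrite ltn_sorted_uniq_leq sort_uniq us sort_sorted //; apply: leq_total.
  by apply: (sorted_ltn_nth ltn_trans 0%N hlt) => //; rewrite inE.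
by rewrite ev -(perm_big _ (permEl (perm_sort leq s))) /= (big_nth 0%N) big_mkord.
Qed.

(** The second bound makes the cost [64 i^2 / 2^(i/2)] of a dyadic step at most
    [U^-11 / (i (i+1))] as soon as the primes up to [U^30] are there. *)
Lemma dyadic_parameters : exists t0, forall t, (t0 <= t)%N -> forall i, (30 * t <= i)%N ->
  (1000 * i ^ 3 <= 2 ^ i./2)%N /\
  (i * (64 * i) * (i * i.+1) * (2 ^ t) ^ 11 <= 2 ^ i./2)%N.
Proof.
have [n1 h1] := expn2_dominates (1000 * 3 ^ 3) 3.
have [n2 h2] := expn2_dominates (128 * 16 ^ 4) 4.
exists (maxn (maxn n1 n2) 1) => t; rewrite !geq_max => /andP[/andP[t1 t2] t0] i ti.
split.
  have n1i : (n1 <= i./2)%N by clear -t1 ti; lia.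
  have i3 : (i <= 3 * i./2)%N by clear -t0 ti; lia.
  apply: leq_trans (h1 _ n1i); rewrite -(mulnA 1000 (3 ^ 3)%N) -(expnMn 3 _ 3).
  by rewrite leq_mul2l leq_exp2r // i3 orbT.
have n2i : (n2 <= i./2 - 11 * t)%N by clear -t2 ti; lia.
have i16 : (i <= 16 * (i./2 - 11 * t))%N by clear -t0 ti; lia.
have ei : (i./2 = (i./2 - 11 * t) + 11 * t)%N by clear -t0 ti; lia.
rewrite ei expnD -expnM (mulnC t) leq_mul2r; apply/orP; right.
apply: leq_trans (h2 _ n2i); rewrite -(mulnA 128 (16 ^ 4)%N) -(expnMn 16 _ 4).
apply: leq_trans (_ : 128 * i ^ 4 <= _)%N; last by rewrite leq_mul2l leq_exp2r // i16 orbT.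
have i1 : (i.+1 <= 2 * i)%N by clear -t0 ti; lia.
rewrite !expnS expn0 muln1; apply: leq_trans (leq_mul (leqnn _) (leq_mul (leqnn i) i1)) _.
by clear; lia.
Qed.

Unset Implicit Arguments.

Theorem theorem1p1 (a b : nat) (ha : (0 < a)%N) (hb : (0 < b)%N)
    (hsq : squarefree b) :
  exists (k : nat) (n : 'I_k -> nat),
    [/\ (1 <= k)%N,
        forall i : 'I_k, (1 < n i)%N,
        forall i j : 'I_k, (i < j)%N -> (n i < n j)%N,
        forall i : 'I_k, product_of_two_distinct_primes (n i)
      & a%:R / b%:R = \sum_(i < k) (n i)%:R^-1 :> rat].
Proof.
have [t1 ht1] := dyadic_parameters.
have [t2 ht2] := expn2_dominates 440 1.
pose t := (maxn (maxn t1 t2) (4 * b)).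
have t1t : (t1 <= t)%N by rewrite !leq_max leqnn.
have t2t : (t2 <= t)%N by rewrite !leq_max leqnn orbT.
have bt : (4 * b <= t)%N by rewrite !leq_max leqnn orbT.
have t0 : (0 < t)%N by apply: leq_trans bt; rewrite muln_gt0.
have t440 : (440 * t <= 2 ^ t)%N by have := ht2 t t2t; rewrite expn1.
have {}ht1 := ht1 t t1t.
have b4 : (4 * b <= 2 ^ t)%N by apply: leq_trans bt (ltnW (ltn_expl _ _)).
clearbody t; clear t1 t2 ht2 t1t t2t bt.
have [A [Q [E [L [s0 [lo [hi [hA hQ hs0 [st hL] [hlo hhi]]]]]]]]] := base_state t0 t440.
case: hA => pA uA mA sA A2.
have e30 : ((2 ^ t) ^ 30 = 2 ^ (30 * t))%N by rewrite -expnM mulnC.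
have e54 : ((2 ^ t) ^ 54 = 2 ^ (54 * t))%N by rewrite -expnM mulnC.
have e4 : ((2 ^ t) ^ 4 = 2 ^ (4 * t))%N by rewrite -expnM mulnC.
rewrite e30 in hL; rewrite e4 in sA.
set U := (2 ^ t)%N in b4 ht1 e30 e54 e4 hlo hhi mA hQ st hL.
have U0 : (0 < U)%N by rewrite expn_gt0.
have pU i j : (i <= j)%N -> (U ^ i <= U ^ j)%N by move=> ij; rewrite leq_pexp2l.
have pU0 i : (0 < U ^ i)%N by rewrite expn_gt0 U0.
have hQA : {in Q, forall q, prime q /\ {in A, forall a, a < q}%N}.
  move=> q /hQ; rewrite mem_primes_in => /and3P[pq q1 _]; split=> // x /mA h.
  exact: leq_ltn_trans h q1.
pose c : rat := (U ^ 11)%:R^-1.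
have c0 : 0 < c by rewrite invr_gt0 ltr0n.
have i00 : (0 < 30 * t)%N by rewrite muln_gt0.
pose v : rat := a%:R / b%:R.
have [s1 hs1] := sum_inv_primes_diverges (U ^ 109) (2 * (v + `|hi|)).
pose n := (s1 + 54 * t + b)%N.
have cost i : (30 * t <= i)%N -> [/\ (1000 * i ^ 3 <= 2 ^ i./2)%N, (size A <= 2 ^ i./2)%N &
     (i * (64 * i))%:R / (2 ^ i./2)%:R <= c * (i%:R^-1 - i.+1%:R^-1)].
  move=> ti; have [h1 h2] := ht1 i ti; split=> //.
    apply: leq_trans sA _; rewrite leq_exp2l //; clear -ti; lia.
  have i0 : (0 < i)%N by apply: leq_trans ti.
  have ir : i%:R != 0 :> rat by rewrite pnatr_eq0 -lt0n.
  have ir1 : i.+1%:R != 0 :> rat by rewrite pnatr_eq0.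
  have -> : i%:R^-1 - i.+1%:R^-1 = (i * i.+1)%:R^-1 :> rat.
    rewrite natrM; move: ir1; rewrite -natr1 => ir1; by field; rewrite ir ir1.
  have w0 : (0 < i * i.+1)%N by rewrite muln_gt0 i0.
  rewrite /c; move: h2 w0 (pU0 11) (expn_gt0 2 i./2) => /=.
  move: (i * (64 * i))%N (i * i.+1)%N (U ^ 11)%N (2 ^ i./2)%N => x w u z h2 w0 u0 z0.
  rewrite -invfM -natrM ler_pdivrMr ?ltr0n // mulrC ler_pdivlMr ?ltr0n ?muln_gt0 ?u0 //.
  by rewrite -natrM ler_nat (mulnC u) mulnA.
have [E2 [L2 [[pL2 uL2 cov2 hE2] hL2]]] :=
  @state_all_primes A Q (U ^ 109) E L s0 lo hi (30 * t) c n i00 A2 pA hQA cost st hL.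
set I := (30 * t + n)%N in cov2 hL2.
set lo2 := lo + _ in cov2.
have In : (n <= I)%N by rewrite leq_addl.
have s0L2 : s0 * (prodl L2)%:R \is a Num.int.
  have /dvdnP[d ->] : (prodl A %| prodl L2)%N.
    apply: prodl_dvd => // x xA; apply: hL2; first exact: (allP pA).
    apply: leq_trans (mA x xA) _; rewrite e54 leq_exp2l //; apply: leq_trans In; rewrite /n; clear; lia.
  by rewrite natrM mulrCA rpredM // rpred_nat.
have L22 : 2 \in L2.
  apply: hL2 => //; apply: (@leq_trans (2 ^ 1)); first by rewrite expn1.
  by rewrite leq_exp2l // (leq_trans i00) // leq_addr.
have hlo2 : lo2 <= lo + c.
  rewrite /lo2 lerD2l -[X in _ <= X]mulr1 ler_pM2l //.
  have : (30 * t)%:R^-1 <= 1 :> rat by rewrite invf_le1 ?ltr0n // ler1n.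
  have : 0 <= I%:R^-1 :> rat by rewrite invr_ge0.
  by clear; move: ((30 * t)%:R^-1) (I%:R^-1) => x y; lra.
have lo2v : lo2 <= v.
  have c1 : c <= U%:R^-1 by rewrite lef_pV2 ?posrE ?ltr0n // ler_nat -{1}(expn1 U) pU.
  have c2 : 4 * U%:R^-1 <= b%:R^-1 :> rat.
    by rewrite ler_pdivrMr ?ltr0n // mulrC ler_pdivlMr ?ltr0n // -(natrM _ 4) ler_nat.
  have c3 : b%:R^-1 <= v by rewrite ler_peMl ?invr_ge0 // ler1n.
  move: c1 c2 c3 hlo hlo2; clear; clearbody lo2 c v.
  by move: (U%:R^-1) (b%:R^-1) => x y; lra.
pose Rs := primes_in (U ^ 109) (2 ^ I).
have hRs : {in Rs, forall P, [/\ P \in L2, P != 2, (2 * P)%:R^-1 <= hi - lo2 & ~ E2 (2 * P)%N]}.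
  move=> P; rewrite mem_primes_in => /and3P[pP P1 P2]; split; first exact: hL2.
  - apply: contraTneq P1 => ->; rewrite -leqNgt; apply: leq_trans (pU 1 109 isT).
    by rewrite expn1; apply: leq_trans b4; rewrite (@leq_trans (4 * 1)) // leq_mul2l.
  - have : (2 * P)%:R^-1 <= c.
      have h2P : (0 < 2 * P)%N by rewrite muln_gt0 (prime_gt0 pP).
      rewrite /c lef_pV2 ?posrE ?ltr0n // ler_nat.
      apply: leq_trans (pU 11 109 isT) _; apply: leq_trans (ltnW P1) _; exact: leq_pmull.
    move: hhi hlo2; rewrite -/c; clear; clearbody lo2 c.
    by move: ((2 * P)%:R^-1) => x; lra.
  move=> /hE2[_ /(_ (dvdn_mulr _ (dvdnn 2)))] h.
  have hP : (P <= 2 * P)%N by apply: leq_pmull.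
  by have := leq_trans P1 (leq_trans hP h); rewrite ltnn.
have cov3 := covers_add_even_edges pL2 uL2 L22 s0L2 (uniq_primes_in _ _) hRs cov2.
have v0 : 0 < v by rewrite divr_gt0 ?ltr0n.
apply: (egyptian_increasing v0 _ (cov3 v _ _)).
- move=> m [/hE2[[[q qQ [p pA' ->]]|[p [r [pL rL pr ->]]]] _]|[P PR ->]].
  + have [pq hq] := hQA q qQ; exists p, q; split=> //; first exact: (allP pA).
    by have := hq p pA'; rewrite ltn_neqAle => /andP[].
  + by exists p, r; split=> //; apply: (allP pL2).
  + have [PL P2 _ _] := hRs P PR; exists 2, P; split=> //; first exact: (allP pL2).
    by rewrite eq_sym.
- rewrite lo2v /=.
  have s1I : (s1 <= I)%N by apply: leq_trans In; rewrite /n; clear; lia.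
  have := hs1 I s1I; rewrite -/Rs.
  have -> : \sum_(P <- Rs) (2 * P)%:R^-1 = (\sum_(P <- Rs) P%:R^-1) / 2 :> rat.
    by rewrite mulr_suml; apply: eq_bigr => P _; rewrite natrM invfM mulrC.
  have := ler_norm (- hi); rewrite normrN; clear; clearbody v.
  by move: (\sum_(_ <- _) _) `|hi| => x y; lra.
rewrite mulrBl rpredB //.
have /dvdnP[d ->] : (b %| prodl L2)%N.
  apply: squarefree_dvd_prodl => // p pp pb; apply: hL2 => //.
  apply: leq_trans (dvdn_leq hb pb) _; apply: leq_trans (ltnW (ltn_expl b (ltnSn 1))) _.
  by rewrite leq_exp2l //; apply: leq_trans In; rewrite /n leq_addl.
by rewrite /v natrM mulrCA divfK ?rpredM ?rpred_nat // pnatr_eq0 -lt0n.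
Qed.
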